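(* Let $k$ be an algebraically closed field with $\mathrm{char}\,k\neq2$, let $X=\{p_1,p_2,p_3,p_4\}\subset\mathbb{P}^2_k$ be four distinct points with no three collinear, and let $R=k[X]$ be its homogeneous coordinate ring. Up to degree shift, the indecomposable graded Ulrich modules over $R$ are exactly the point modules $L_i=k[X]/I(p_i)$, $i=1,2,3,4$.
   Context: A graded $R$-module $M$ is MCM if it admits an $M$-regular sequence of length $\dim R=1$. For a graded MCM module $M\neq0$, its Hilbert series has the form $H_M(t)=Q_M(t)/(1-t)$ with $Q_M$ a Laurent polynomial, $Q_M(1)\ne0$; $e(M)=Q_M(1)$ is the multiplicity and $\nu(M)$ the minimal number of generators. One has $\nu(M)\le e(M)$, and $M$ is called Ulrich if it is MCM and $\nu(M)=e(M)$. *)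

(* Defs.v *)
From HB Require Import structures.
From mathcomp Require Import all_boot all_order all_algebra.
From mathcomp Require Import ring_quotient mpoly.

Set Implicit Arguments.
Unset Strict Implicit.
Unset Printing Implicit Defensive.

Import Order.TTheory GRing.Theory Num.Theory.
Local Open Scope ring_scope.
Local Open Scope quotient_scope.

(** * Points of the projective plane *)

Section ProjectivePlane.
Variable k : fieldType.

(* A point is given by a choice of homogeneous coordinates; equality of points
   is [same_point], not equality of coordinate vectors. *)
Record ppoint := PPoint { pcoord :> 'rV[k]_3; pcoord_neq0 : pcoord != 0 }.

Definition same_point (p q : ppoint) : Prop :=
  exists2 c : k, c != 0 & (q : 'rV[k]_3) = c *: (p : 'rV[k]_3).

(* [l] holds the coefficients of the equation of a line. *)
Definition on_line (l : 'rV[k]_3) (p : ppoint) : Prop :=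
  \sum_(i < 3) l 0 i * p 0 i = 0.

Definition collinear (p q r : ppoint) : Prop :=
  exists2 l : 'rV[k]_3, l != 0 & [/\ on_line l p, on_line l q & on_line l r].

Definition evalp (p : ppoint) (f : {mpoly k[3]}) : k := f.@[fun i => p 0 i].

End ProjectivePlane.

(** * The homogeneous vanishing ideal and the homogeneous coordinate ring *)

Section VanishingIdeal.
Variables (k : fieldType) (n : nat) (X : 'I_n.+1 -> ppoint k).

(* A polynomial lies in the ideal generated by the homogeneous polynomials
   vanishing on X iff all its homogeneous components vanish on X; those of
   degree at least [msize f] are zero. *)
Definition vanishing_ideal : {pred {mpoly k[3]}} :=
  [pred f : {mpoly k[3]} |
    [forall i, [forall d : 'I_(msize f), evalp (X i) (pihomog mdeg d f) == 0]]].

Lemma vanishing_idealP (f : {mpoly k[3]}) :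
  reflect (forall i d, evalp (X i) (pihomog mdeg d f) = 0)
          (f \in vanishing_ideal).
Proof.
rewrite inE; apply: (iffP forallP) => [h i d|h i]; last first.
  by apply/forallP => d; apply/eqP.
have [ltd|led] := ltnP d (msize f).
  by move/forallP: (h i) => /(_ (Ordinal ltd))/eqP.
rewrite pihomogE big_seq_cond big1 ?/evalp ?raddf0 // => m /andP[ms /eqP md].
by have := msize_mdeg_lt ms; rewrite md ltnNge led.
Qed.

Lemma vanishing_ideal_homogP d (f : {mpoly k[3]}) : f \is d.-homog ->
  reflect (forall i, evalp (X i) f = 0) (f \in vanishing_ideal).
Proof.
move=> hf; apply: (iffP (vanishing_idealP f)) => h i.
  by rewrite -(h i d) pihomog_dE.
move=> e; have [<-|ne] := eqVneq d e; first by rewrite pihomog_dE.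
by rewrite (pihomog_ne0 ne hf) /evalp raddf0.
Qed.

Lemma vanishing_ideal0 : 0 \in vanishing_ideal.
Proof. by apply/vanishing_idealP => i d; rewrite raddf0 /evalp raddf0. Qed.

Lemma vanishing_idealB : {in vanishing_ideal &, forall f g, f - g \in vanishing_ideal}.
Proof.
move=> f g /vanishing_idealP hf /vanishing_idealP hg; apply/vanishing_idealP => i d.
by rewrite raddfB /evalp raddfB /= -/(evalp _ _) hf -/(evalp _ _) hg subrr.
Qed.

Lemma vanishing_idealD : {in vanishing_ideal &, forall f g, f + g \in vanishing_ideal}.
Proof.
move=> f g hf hg; rewrite -[g]opprK; apply: vanishing_idealB => //.
by rewrite -sub0r; apply: vanishing_idealB; rewrite // vanishing_ideal0.
Qed.

Lemma vanishing_ideal_sum (I : Type) (r : seq I) (F : I -> {mpoly k[3]}) :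
  (forall i, F i \in vanishing_ideal) -> \sum_(i <- r) F i \in vanishing_ideal.
Proof.
move=> hF; elim: r => [|i r IH]; first by rewrite big_nil vanishing_ideal0.
by rewrite big_cons; apply: vanishing_idealD.
Qed.

Lemma vanishing_ideal_closed : idealr_closed vanishing_ideal.
Proof.
split=> [||a f g hf hg]; first exact: vanishing_ideal0.
  apply/negP => /(@vanishing_ideal_homogP 0 1 (dhomog1 _ _)) /(_ ord0).
  by rewrite /evalp rmorph1 => /eqP; rewrite oner_eq0.
apply: vanishing_idealD => //.
rewrite (pihomog_partitionE (leqnn (mmeasure mdeg a))) mulr_suml; apply: vanishing_ideal_sum => d.
rewrite (pihomog_partitionE (leqnn (mmeasure mdeg f))) mulr_sumr; apply: vanishing_ideal_sum => e.
have hom := dhomogM (pihomogP mdeg d a) (pihomogP mdeg e f).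
apply/(vanishing_ideal_homogP hom) => i.
rewrite /evalp rmorphM /=; move/vanishing_idealP: hf => /(_ i e).
by rewrite /evalp => ->; rewrite mulr0.
Qed.

HB.instance Definition _ :=
  isIdealr.Build {mpoly k[3]} vanishing_ideal vanishing_ideal_closed.

Definition coord_ring : comNzRingType := {ideal_quot vanishing_ideal}.

Definition cr_proj (f : {mpoly k[3]}) : coord_ring :=
  \pi_({ideal_quot vanishing_ideal}) f.

Definition cr_repr (r : coord_ring) : {mpoly k[3]} :=
  repr (r : {ideal_quot vanishing_ideal}).

Lemma cr_proj_zmod_morphism : zmod_morphism cr_proj.
Proof. exact: raddfB. Qed.

Lemma cr_proj_monoid_morphism : monoid_morphism cr_proj.
Proof. by split; [exact: rmorph1 | exact: rmorphM]. Qed.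

HB.instance Definition _ := GRing.isZmodMorphism.Build {mpoly k[3]} coord_ring
  cr_proj cr_proj_zmod_morphism.
HB.instance Definition _ := GRing.isMonoidMorphism.Build {mpoly k[3]} coord_ring
  cr_proj cr_proj_monoid_morphism.

Lemma cr_reprK : cancel cr_repr cr_proj.
Proof. by move=> r; rewrite /cr_proj /cr_repr reprK. Qed.

Lemma cr_proj_eq0 f : (cr_proj f == 0) = (f \in vanishing_ideal).
Proof.
have -> : (0 : coord_ring) = cr_proj 0 by rewrite raddf0.
by rewrite /cr_proj -Quotient.idealrBE subr0.
Qed.

(* The structure map from k to the coordinate ring. *)
Definition cr_const (c : k) : coord_ring := cr_proj c%:MP.

Definition cr_homog (d : nat) (r : coord_ring) : Prop :=
  exists2 f : {mpoly k[3]}, f \is d.-homog & r = cr_proj f.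

End VanishingIdeal.

(** * The quotient of a ring by an ideal, as a module *)

Section QuotientModule.
Variables (R : comNzRingType) (J : idealr R).

Definition quot_carrier : Type := {ideal_quot J}.
HB.instance Definition _ := GRing.ComNzRing.on quot_carrier.

Definition quot_proj (r : R) : quot_carrier := \pi_({ideal_quot J}) r.

Lemma quot_proj_zmod_morphism : zmod_morphism quot_proj.
Proof. exact: raddfB. Qed.

Lemma quot_proj_monoid_morphism : monoid_morphism quot_proj.
Proof. by split; [exact: rmorph1 | exact: rmorphM]. Qed.

HB.instance Definition _ := GRing.isZmodMorphism.Build R quot_carrier
  quot_proj quot_proj_zmod_morphism.
HB.instance Definition _ := GRing.isMonoidMorphism.Build R quot_carrier
  quot_proj quot_proj_monoid_morphism.

Lemma quot_proj_surj (y : quot_carrier) : exists r, y = quot_proj r.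
Proof. by exists (repr (y : {ideal_quot J})); rewrite /quot_proj reprK. Qed.

Lemma quot_proj_eq0 r : (quot_proj r == 0) = (r \in J).
Proof.
have -> : (0 : quot_carrier) = quot_proj 0 by rewrite raddf0.
by rewrite /quot_proj -Quotient.idealrBE subr0.
Qed.

Definition quot_scale (r : R) (y : quot_carrier) : quot_carrier := quot_proj r * y.

Fact quot_scaleA a b y : quot_scale a (quot_scale b y) = quot_scale (a * b) y.
Proof. by rewrite /quot_scale rmorphM mulrA. Qed.
Fact quot_scale1 : left_id 1 quot_scale.
Proof. by move=> y; rewrite /quot_scale rmorph1 mul1r. Qed.
Fact quot_scaleDr : right_distributive quot_scale +%R.
Proof. by move=> a y z; rewrite /quot_scale mulrDr. Qed.
Fact quot_scaleDl y : {morph quot_scale^~ y : a b / a + b}.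
Proof. by move=> a b; rewrite /quot_scale rmorphD mulrDl. Qed.

HB.instance Definition _ := GRing.Zmodule_isLmodule.Build R quot_carrier
  quot_scaleA quot_scale1 quot_scaleDr quot_scaleDl.

Definition quot_module : lmodType R := quot_carrier.

End QuotientModule.

(** * Graded modules over the homogeneous coordinate ring *)

Section GradedModules.
Variables (k : fieldType) (n : nat) (X : 'I_n.+1 -> ppoint k).
Local Notation R := (coord_ring X).

(* A Z-graded R-module: the last two axioms say that the module is the internal
   direct sum of its components. *)
Record gmodule := GModule {
  gcarrier :> lmodType R;
  gcomp : int -> gcarrier -> Prop;
  gcomp0 : forall d, gcomp d 0;
  gcompB : forall d u v, gcomp d u -> gcomp d v -> gcomp d (u - v);
  gcompZ : forall (e : nat) d r u,
    cr_homog e r -> gcomp d u -> gcomp (d + e%:Z) (r *: u);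
  gcomp_span : forall u, exists (s : seq int) (c : int -> gcarrier),
    (forall d, gcomp d (c d)) /\ u = \sum_(d <- s) c d;
  gcomp_indep : forall (s : seq int) (c : int -> gcarrier), uniq s ->
    (forall d, gcomp d (c d)) -> \sum_(d <- s) c d = 0 ->
    forall d, d \in s -> c d = 0 }.

(* Isomorphism of graded modules, of degree 0. *)
Definition giso (M N : gmodule) : Prop :=
  exists f : {linear M -> N},
    bijective f /\ forall d u, gcomp d u <-> gcomp d (f u).

Section Shift.
Variables (M : gmodule) (s : int).

Definition shift_comp (d : int) : M -> Prop := @gcomp M (d + s).

Fact shift_comp0 d : shift_comp d 0.
Proof. exact: gcomp0. Qed.

Fact shift_compB d u v : shift_comp d u -> shift_comp d v -> shift_comp d (u - v).
Proof. exact: gcompB. Qed.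

Fact shift_compZ (e : nat) d r u :
  cr_homog e r -> shift_comp d u -> shift_comp (d + e%:Z) (r *: u).
Proof. by move=> hr hu; rewrite /shift_comp addrAC; apply: gcompZ. Qed.

Fact shift_comp_span (u : M) : exists (t : seq int) (c : int -> M),
  (forall d, shift_comp d (c d)) /\ u = \sum_(d <- t) c d.
Proof.
have [t [c [hc ->]]] := gcomp_span u.
exists [seq d - s | d <- t], (fun d => c (d + s)); split=> [d|]; first exact: hc.
by rewrite big_map; apply: eq_bigr => d _; rewrite subrK.
Qed.

Fact shift_comp_indep (t : seq int) (c : int -> M) : uniq t ->
  (forall d, shift_comp d (c d)) -> \sum_(d <- t) c d = 0 ->
  forall d, d \in t -> c d = 0.
Proof.
move=> ut hc sum0 d dt.
have := @gcomp_indep M [seq e + s | e <- t] (fun e => c (e - s)).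
rewrite map_inj_uniq; last exact: addIr.
move=> /(_ ut) h; rewrite -[d](addrK s); apply: h; last exact: map_f.
  by move=> e; have := hc (e - s); rewrite /shift_comp subrK.
by rewrite big_map -[RHS]sum0; apply: eq_bigr => e _; rewrite addrK.
Qed.

(* The degree shift M(s), with M(s)_d = M_(d + s). *)
Definition gshift : gmodule :=
  GModule shift_comp0 shift_compB shift_compZ shift_comp_span shift_comp_indep.

End Shift.

(** ** Generators *)

Definition generates (M : lmodType R) (m : nat) (g : 'I_m -> M) : Prop :=
  forall u : M, exists a : 'I_m -> R, u = \sum_i a i *: g i.

Definition fin_gen (M : lmodType R) : Prop :=
  exists (m : nat) (g : 'I_m -> M), generates g.

(* nu(M) = m *)
Definition min_num_gens (M : lmodType R) (m : nat) : Prop :=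
  (exists g : 'I_m -> M, generates g) /\
  forall (m' : nat) (g : 'I_m' -> M), generates g -> (m <= m')%N.

(** ** Maximal Cohen-Macaulay modules *)

(* The submodule (r_1, ..., r_l)M. *)
Definition in_seqM (M : lmodType R) (rs : seq R) (u : M) : Prop :=
  exists v : 'I_(size rs) -> M, u = \sum_(i < size rs) rs`_i *: v i.

Definition regular_seq (M : lmodType R) (rs : seq R) : Prop :=
  (forall i, (i < size rs)%N -> forall u : M,
     in_seqM (take i rs) (rs`_i *: u) -> in_seqM (take i rs) u) /\
  exists u : M, ~ in_seqM rs u.

(* R has dimension 1, and graded regular sequences consist of homogeneous
   elements of the irrelevant ideal.  Without the latter condition,
   1 + x would be regular on the direct sum of a point module and k. *)
Definition is_MCM (M : gmodule) : Prop :=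
  fin_gen M /\
  exists rs : seq R,
    [/\ size rs = 1%N,
        forall r, r \in rs -> exists2 d : nat, (0 < d)%N & cr_homog d r
      & regular_seq M rs].

(** ** Hilbert series, multiplicity and Ulrich modules *)

(* dim_k M_d = m *)
Definition comp_dim (M : gmodule) (d : int) (m : nat) : Prop :=
  exists b : 'I_m -> M, (forall i, gcomp d (b i)) /\
    forall u, gcomp d u ->
      exists! c : {ffun 'I_m -> k}, u = \sum_i cr_const X (c i) *: b i.

(* H_M(t) = Q(t) / (1 - t) for the Laurent polynomial Q(t) = t^a q(t): the
   coefficient of t^d in Q(t) (1 + t + t^2 + ...) is the sum of the
   coefficients of Q in degrees up to d. *)
Definition hilbert_numerator (M : gmodule) (a : int) (q : {poly int}) : Prop :=
  exists h : int -> nat, (forall d, comp_dim M d (h d)) /\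
    forall d, (h d)%:Z = if a <= d then \sum_(i < `|d - a|%N.+1) q`_i else 0.

(* e(M) = e, that is, Q(1) = e. *)
Definition multiplicity (M : gmodule) (e : int) : Prop :=
  exists a q, hilbert_numerator M a q /\ e = q.[1].

Definition is_Ulrich (M : gmodule) : Prop :=
  is_MCM M /\ exists m : nat, min_num_gens M m /\ multiplicity M m%:Z.

(** ** Indecomposable graded modules *)

Definition is_graded_submod (M : gmodule) (N : M -> Prop) : Prop :=
  [/\ N 0,
      forall (r : R) u v, N u -> N v -> N (r *: u + v)
    & forall u, N u -> exists (s : seq int) (c : int -> M),
        (forall d, gcomp d (c d) /\ N (c d)) /\ u = \sum_(d <- s) c d].

Definition is_direct_sum (M : lmodType R) (N P : M -> Prop) : Prop :=
  (forall u, exists v w, [/\ N v, P w & u = v + w]) /\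
  (forall u, N u -> P u -> u = 0).

Definition indecomposable (M : gmodule) : Prop :=
  (exists u : M, u <> 0) /\
  forall N P : M -> Prop,
    is_graded_submod N -> is_graded_submod P -> is_direct_sum N P ->
    (forall u, N u -> u = 0) \/ (forall u, P u -> u = 0).

End GradedModules.

(** * Point modules *)

Section PointModule.
Variables (k : fieldType) (n : nat) (X : 'I_n.+1 -> ppoint k) (i : 'I_n.+1).
Local Notation R := (coord_ring X).

Definition point_ideal : {pred {mpoly k[3]}} := vanishing_ideal (fun _ : 'I_1 => X i).

(* The image of I(X i) in the coordinate ring; see [point_idealRP]. *)
Definition point_idealR : {pred R} := [pred r : R | cr_repr r \in point_ideal].

Lemma vanishing_sub_point f : f \in vanishing_ideal X -> f \in point_ideal.
Proof. by move/vanishing_idealP => h; apply/vanishing_idealP => _ d; apply: h. Qed.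

Lemma point_idealR_proj f : (cr_proj X f \in point_idealR) = (f \in point_ideal).
Proof.
have h : cr_repr (cr_proj X f) - f \in point_ideal.
  by apply: vanishing_sub_point; rewrite -cr_proj_eq0 raddfB /= cr_reprK subrr.
rewrite [LHS]inE; apply/idP/idP => hf.
  by rewrite -[f](subKr (cr_repr (cr_proj X f))); apply: vanishing_idealB.
by rewrite -[cr_repr _](subrK f); apply: vanishing_idealD.
Qed.

Lemma point_idealRP r :
  reflect (exists2 f, f \in point_ideal & r = cr_proj X f) (r \in point_idealR).
Proof.
apply: (iffP idP) => [h|[f hf ->]]; last by rewrite point_idealR_proj.
by exists (cr_repr r); rewrite ?cr_reprK.
Qed.

Lemma point_idealR_closed : idealr_closed point_idealR.
Proof.
have [h0 h1 h] := vanishing_ideal_closed (fun _ : 'I_1 => X i).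
split.
- by rewrite -(rmorph0 (cr_proj X)) point_idealR_proj.
- by rewrite -(rmorph1 (cr_proj X)) point_idealR_proj.
move=> a u v /point_idealRP[f hf ->] /point_idealRP[g hg ->].
by rewrite -[a]cr_reprK -rmorphM -rmorphD point_idealR_proj; apply: h.
Qed.

HB.instance Definition _ := isIdealr.Build R point_idealR point_idealR_closed.

Local Notation L := (quot_module point_idealR).
Local Notation pr := (quot_proj point_idealR).

Definition point_comp (d : int) (y : L) : Prop :=
  match d with
  | Posz e => exists2 r, cr_homog e r & y = pr r
  | Negz _ => y = 0
  end.

Lemma point_comp_poly (c : int -> L) : (forall d, point_comp d (c d)) ->
  forall d : int, exists2 f : {mpoly k[3]},
    (if d is Posz e then f \is e.-homog else f == 0) & c d = pr (cr_proj X f).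
Proof.
move=> hc d; move: (hc d); case: d => [e [r [f hf ->] ->]|e /= ->]; first by exists f.
by exists 0 => //; rewrite !raddf0.
Qed.

Lemma pr_proj_eq0 f : (pr (cr_proj X f) == 0) = (f \in point_ideal).
Proof. by rewrite quot_proj_eq0 point_idealR_proj. Qed.

Lemma point_comp_indep (s : seq int) (c : int -> L) : uniq s ->
  (forall d, point_comp d (c d)) -> \sum_(d <- s) c d = 0 ->
  forall d, d \in s -> c d = 0.
Proof.
move=> us hc sum0 d ds.
have [F hF] : exists F : int -> {mpoly k[3]}, forall d, d \in s ->
    (if d is Posz e then F d \is e.-homog else F d == 0) /\ c d = pr (cr_proj X (F d)).
  elim: s us {sum0 ds} => [|a s IH] /=; first by exists (fun _ => 0).
  case/andP=> nas /IH[F hF]; have [f hf ef] := point_comp_poly hc a.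
  exists (fun d => if d == a then f else F d) => d'; rewrite inE.
  by have [->|_] //= := eqVneq d' a => /hF.
case: (hF d ds); case: d ds => [e|e] ds hd -> ; last by rewrite (eqP hd) !raddf0.
have /vanishing_idealP hs : \sum_(d <- s) F d \in point_ideal.
  rewrite -pr_proj_eq0 !raddf_sum -[X in _ == X]sum0; apply/eqP.
  by rewrite big_seq [RHS]big_seq; apply: eq_bigr => d' /hF[].
apply/eqP; rewrite pr_proj_eq0; apply/(vanishing_ideal_homogP _ hd) => j.
rewrite -(hs j e) raddf_sum (bigD1_seq (Posz e)) //= pihomog_dE // big_seq_cond.
rewrite big1 ?addr0 // => d' /andP[/hF[hd' _] ne]; case: d' hd' ne => [e'|e'] hd' ne.
  by rewrite (pihomog_ne0 _ hd').
by rewrite (eqP hd') raddf0.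
Qed.

Lemma point_comp0 d : point_comp d 0.
Proof.
case: d => [d|d] //=; exists 0; last by rewrite raddf0.
by exists 0; rewrite ?raddf0 // dhomog0.
Qed.

Lemma point_compB d u v : point_comp d u -> point_comp d v -> point_comp d (u - v).
Proof.
case: d => [d|d] /=; last by move=> -> ->; rewrite subrr.
move=> [_ [f hf ->] ->] [_ [g hg ->] ->]; exists (cr_proj X (f - g)).
  by exists (f - g) => //; apply: rpredB.
by rewrite !raddfB.
Qed.

Lemma point_compZ (e : nat) d r (u : L) :
  cr_homog e r -> point_comp d u -> point_comp (d + e%:Z) (r *: u).
Proof.
case: d => [d|d] [f hf ->].
  move=> [_ [g hg ->] ->]; exists (cr_proj X (g * f)).
    by exists (g * f) => //; apply: dhomogM.
  by rewrite mulrC !rmorphM.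
by move=> ->; rewrite scaler0; apply: point_comp0.
Qed.

Lemma point_comp_span (u : L) : exists (s : seq int) (c : int -> L),
  (forall d, point_comp d (c d)) /\ u = \sum_(d <- s) c d.
Proof.
have [r ->] := quot_proj_surj u; rewrite -[r]cr_reprK.
set f := cr_repr r.
exists (map Posz (index_iota 0 (mmeasure mdeg f))).
exists (fun d => if d is Posz e then pr (cr_proj X (pihomog mdeg e f)) else 0); split.
  case=> [d|d] //=; exists (cr_proj X (pihomog mdeg d f)) => //.
  by exists (pihomog mdeg d f) => //; apply: pihomogP.
rewrite big_map big_mkord {1}(pihomog_partitionE (leqnn (mmeasure mdeg f))).
by rewrite !raddf_sum.
Qed.

(* L_i = k[X] / I(X i), graded by degree. *)
Definition point_module : gmodule X :=
  GModule point_comp0 point_compB point_compZ point_comp_span point_comp_indep.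

End PointModule.

(* Main.v *)
Require Import Defs.
From HB Require Import structures.
From mathcomp Require Import all_boot all_order all_algebra.
From mathcomp Require Import ring_quotient mpoly.
From mathcomp Require Import zify.
From Stdlib Require Import Classical IndefiniteDescription.

(** Write R for the coordinate ring of the points X_0, ..., X_n.  Restricting
    a form to the line through the origin of k^3 that represents X_i gives a
    graded ring morphism theta_i : R -> k[t] ([restr]) with kernel the ideal of
    X_i, and the theta_i are jointly injective; every computation in R is made
    through them.  Choose a linear form l that vanishes at no X_i, and forms
    E_i of degree n that vanish at the X_j with j <> i, scaled so that
    sum_i E_i = l^n.  Up to powers of l the E_i are orthogonal idempotents.

    Let M be Ulrich and indecomposable.  A positive power of any homogeneous
    element of positive degree is a multiple of l, so l is regular on M
    ([MCM_regular]).  Hence multiplication by l embeds each M_d in M_(d+1), and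
    for large d all the dimensions are e(M).  Picking, degree by degree,
    generators that complement l M_d in M_(d+1) yields e(M) generators of M; if
    some linear form sent an element of M_d outside l M_d, one generator fewer
    would do.  As nu(M) = e(M), every form of degree p maps M_d into l^p M_d
    ([Ulrich_divideX]): the fractions E_i / l^n act on M.

    Since these fractions add up to 1, one of them does not kill a given
    nonzero element w of lowest degree d0, and gives u <> 0 in M_d0 with
    E_i w = l^n u; the ideal of X_i kills u.  In a large degree M_d is a fixed
    space k^m in which the image of u has a nonzero coordinate; the elements v
    whose image under E_i has zero coordinate there form a graded submodule,
    because a form r acts after E_i as the scalar r(X_i) / l(X_i)^e times l^e.
    This submodule is a complement of R u = k[l] u, so indecomposability gives
    M = R u, and R u is a shifted point module ([Ulrich_generator]).

    Conversely a module R u with annihilator the ideal of X_i is k[l] u, free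
    of rank one over k[l]: its Hilbert series is t^d0 / (1 - t), it has one
    generator, and it is indecomposable because the ideal of X_i is prime. *)

Set Implicit Arguments.
Unset Strict Implicit.
Unset Printing Implicit Defensive.

Import Order.TTheory GRing.Theory Num.Theory.
Local Open Scope ring_scope.

(** * Restriction of forms to the points *)

Section LineRestriction.
Variable k : fieldType.

(** The polynomial t |-> f(t p). *)
Definition line_poly (p : ppoint k) : {mpoly k[3]} -> {poly k} :=
  mmap polyC (fun a => p 0 a *: 'X).

HB.instance Definition _ p := GRing.RMorphism.on (line_poly p).

Lemma line_polyX p m :
  line_poly p 'X_[m] = (\prod_a p 0 a ^+ m a) *: 'X^(mdeg m).
Proof.
rewrite /line_poly mmapX /mmap1 mdegE.
elim/big_rec3: _ => [|a x y z _ ->]; first by rewrite scale1r.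
by rewrite exprZn -scalerAl -scalerAr scalerA exprD.
Qed.

(** The substitution t p gives every monomial of degree d the factor t^d, so the
    coefficients separate the homogeneous components: membership in a vanishing
    ideal becomes the vanishing of ring morphisms. *)
Lemma coef_line_poly p f d : (line_poly p f)`_d = evalp p (pihomog mdeg d f).
Proof.
rewrite [in LHS](mpolyE f) !raddf_sum /= coef_sum pihomogE /evalp raddf_sum /=.
rewrite [RHS]big_mkcond; apply: eq_bigr => m _ /=.
rewrite -mul_mpolyC rmorphM /= {1}/line_poly mmapC -/(line_poly p _) line_polyX.
rewrite coefCM coefZ coefXn eq_sym; case: ifP => _; last by rewrite !mulr0.
by rewrite mulr1 mevalM mevalC mevalX.
Qed.

Lemma line_poly_homog p f d : f \is d.-homog -> line_poly p f = evalp p f *: 'X^d.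
Proof.
move=> hf; apply/polyP => e; rewrite coef_line_poly coefZ coefXn eq_sym.
have [<-|ne] := eqVneq d e; first by rewrite pihomog_dE // mulr1.
by rewrite (pihomog_ne0 ne hf) /evalp raddf0 mulr0.
Qed.

Lemma vanishing_ideal_line n (X : 'I_n.+1 -> ppoint k) f :
  reflect (forall i, line_poly (X i) f = 0) (f \in vanishing_ideal X).
Proof.
apply: (iffP (vanishing_idealP X f)) => h i => [|d].
  by apply/polyP => d; rewrite coef_line_poly h coef0.
by rewrite -coef_line_poly h coef0.
Qed.

End LineRestriction.

Section Restriction.
Variables (k : fieldType) (n : nat) (X : 'I_n.+1 -> ppoint k).
Local Notation R := (coord_ring X).

Definition restr (i : 'I_n.+1) (r : R) : {poly k} := line_poly (X i) (cr_repr r).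

Lemma restr_proj i f : restr i (cr_proj X f) = line_poly (X i) f.
Proof.
apply/eqP; rewrite -subr_eq0 -raddfB; apply/eqP; move: i; apply/vanishing_ideal_line.
by rewrite -cr_proj_eq0 raddfB /= cr_reprK subrr.
Qed.

Fact restr_zmod i : zmod_morphism (restr i).
Proof.
move=> a b; rewrite -[a]cr_reprK -[b]cr_reprK -raddfB !restr_proj; exact: raddfB.
Qed.
Fact restr_monoid i : monoid_morphism (restr i).
Proof.
split=> [|a b]; first by rewrite -(rmorph1 (cr_proj X)) restr_proj rmorph1.
by rewrite -[a]cr_reprK -[b]cr_reprK -rmorphM !restr_proj rmorphM.
Qed.
HB.instance Definition _ i :=
  GRing.isZmodMorphism.Build R {poly k} (restr i) (restr_zmod i).
HB.instance Definition _ i :=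
  GRing.isMonoidMorphism.Build R {poly k} (restr i) (restr_monoid i).

(** R embeds in a product of copies of k[t], one for each point; identities
    between elements of R are proved by comparing restrictions. *)
Lemma restr_inj (r s : R) : (forall i, restr i r = restr i s) -> r = s.
Proof.
move=> h; apply/eqP; rewrite -subr_eq0 -[r]cr_reprK -[s]cr_reprK -raddfB cr_proj_eq0.
by apply/vanishing_ideal_line => i; rewrite raddfB /= -!restr_proj !cr_reprK h subrr.
Qed.

Lemma point_ideal_restr i r : (r \in point_idealR i) = (restr i r == 0).
Proof.
rewrite -[r]cr_reprK point_idealR_proj restr_proj.
have h := @vanishing_ideal_line k 0 (fun _ => X i) (cr_repr r).
by apply: (sameP h); apply: (iffP eqP) => [e _|/(_ ord0)].
Qed.

Lemma restr_const i c : restr i (cr_const X c) = c%:P.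
Proof. by rewrite restr_proj /line_poly mmapC. Qed.

Lemma cr_constB c c' : cr_const X (c - c') = cr_const X c - cr_const X c'.
Proof. by apply: restr_inj => i; rewrite raddfB /= !restr_const polyCB. Qed.
Lemma cr_constD c c' : cr_const X (c + c') = cr_const X c + cr_const X c'.
Proof. by apply: restr_inj => i; rewrite raddfD /= !restr_const polyCD. Qed.
Lemma cr_constM c c' : cr_const X (c * c') = cr_const X c * cr_const X c'.
Proof. by apply: restr_inj => i; rewrite rmorphM /= !restr_const polyCM. Qed.
Lemma cr_const0 : cr_const X 0 = 0.
Proof. by apply: restr_inj => i; rewrite raddf0 restr_const. Qed.
Lemma cr_const1 : cr_const X 1 = 1.
Proof. by apply: restr_inj => i; rewrite rmorph1 restr_const. Qed.

Lemma cr_homog_const c : cr_homog 0 (cr_const X c).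
Proof. by exists c%:MP => //; rewrite -alg_mpolyC; apply/dhomogZ/dhomog1. Qed.

Lemma cr_homogM d e (r s : R) : cr_homog d r -> cr_homog e s -> cr_homog (d + e) (r * s).
Proof.
move=> [f hf ->] [g hg ->]; exists (f * g); first exact: dhomogM.
by rewrite rmorphM.
Qed.

Lemma cr_homogX d e (r : R) : cr_homog d r -> cr_homog (d * e) (r ^+ e).
Proof. by move=> [f hf ->]; exists (f ^+ e); rewrite ?rmorphXn //; apply: dhomogMn. Qed.

Lemma cr_homogZ d c (r : R) : cr_homog d r -> cr_homog d (cr_const X c * r).
Proof. by move=> hr; apply: (cr_homogM (cr_homog_const c) hr). Qed.

Lemma restr_homog i d r : cr_homog d r -> exists c, restr i r = c *: 'X^d.
Proof.
by case=> f hf ->; exists (evalp (X i) f); rewrite restr_proj (line_poly_homog _ hf).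
Qed.

Lemma cr_homog_ind (P : R -> Prop) : P 0 -> (forall r s, P r -> P s -> P (r + s)) ->
  (forall d r, cr_homog d r -> P r) -> forall r, P r.
Proof.
move=> P0 PD Ph r; rewrite -[r]cr_reprK; set f := cr_repr r.
rewrite (pihomog_partitionE (leqnn (mmeasure mdeg f))) raddf_sum /=.
elim/big_ind: _ => // d _; apply: (Ph d); exists (pihomog mdeg d f) => //.
exact: pihomogP.
Qed.

End Restriction.

(** * Linear forms and separating forms *)

Section SpecialForms.
Variables (k : fieldType) (n : nat) (X : 'I_n.+1 -> ppoint k).
Local Notation R := (coord_ring X).

(** R is generated over k by its linear elements, so a graded property stable
    under sums and products has to be checked in degrees 0 and 1 only. *)
Lemma standard_graded (P : nat -> R -> Prop) :
    (forall d, P d 0) -> (forall d r s, P d r -> P d s -> P d (r + s)) ->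
    (forall c, P 0%N (cr_const X c)) ->
    (forall d e r s, P d r -> P e s -> P (d + e)%N (r * s)) ->
    (forall r, cr_homog 1 r -> P 1%N r) ->
  forall d r, cr_homog d r -> P d r.
Proof.
move=> P0 PD PC PM P1 d _ [f hf ->]; rewrite (mpolyE f) raddf_sum /= big_seq.
elim/big_ind: _ => [||m mf]; [exact: P0|exact: PD|].
rewrite -(dhomogP _ _ _ hf m mf) -mul_mpolyC rmorphM /= -[mdeg m]add0n.
apply: (PM); first exact: PC.
rewrite mpolyXE_id rmorph_prod /= mdegE.
elim/big_ind2: _ => [|a r b s|a _]; first by rewrite -cr_const1.
  exact: PM.
elim: (m a) => [|e IH]; first by rewrite expr0 rmorph1 -cr_const1.
rewrite exprS rmorphM -add1n; apply: (PM) => //; apply: P1; exists 'X_a => //.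
by rewrite dhomogX /= mdeg1.
Qed.

Definition linform (v : 'I_3 -> k) : R := cr_proj X (\sum_a v a *: 'X_a).

Lemma linform_homog v : cr_homog 1 (linform v).
Proof.
exists (\sum_a v a *: 'X_a) => //; apply: rpred_sum => a _.
by apply: dhomogZ; rewrite dhomogX /= mdeg1.
Qed.

Lemma restr_linform i v : restr i (linform v) = (\sum_a v a * X i 0 a) *: 'X.
Proof.
rewrite restr_proj raddf_sum scaler_suml; apply: eq_bigr => a _ /=.
by rewrite -mul_mpolyC rmorphM /= /line_poly mmapC mmapX mmap1U mul_polyC scalerA.
Qed.

(** If all 2 x 2 minors of the coordinates of the two points vanish, the points
    agree; a nonzero minor q_b p_a - q_a p_b is the value at p of the linear
    form q_b x_a - q_a x_b, which vanishes at q. *)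
Lemma separating_linform i j : ~ same_point (X i) (X j) ->
  exists2 v : 'I_3 -> k, \sum_a v a * X j 0 a = 0 & \sum_a v a * X i 0 a != 0.
Proof.
set p := X i; set q := X j => npq; apply: NNPP => hno.
have minor a b : q 0 b * p 0 a = q 0 a * p 0 b.
  apply/eqP; rewrite -subr_eq0; apply/negPn/negP => nz; apply: hno.
  (* The coefficients of the form q_b x_a - q_a x_b, written so that they make
     sense also when a = b. *)
  pose v c := (if c == a then q 0 b else 0) - (if c == b then q 0 a else 0).
  have sum_v (r : ppoint k) : \sum_c v c * r 0 c = q 0 b * r 0 a - q 0 a * r 0 b.
    under eq_bigr do rewrite mulrBl; rewrite sumrB; congr (_ - _).
      rewrite (bigD1 a) //= eqxx big1 ?addr0 // => c /negPf->; exact: mul0r.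
    rewrite (bigD1 b) //= eqxx big1 ?addr0 // => c /negPf->; exact: mul0r.
  by exists v; rewrite sum_v // mulrC subrr.
have [b pb] : exists b, p 0 b != 0.
  apply: NNPP => h; move/eqP: (pcoord_neq0 p); apply; apply/rowP => b.
  by rewrite mxE; apply/eqP/negPn/negP => nz; apply: h; exists b.
apply: npq; exists (q 0 b / p 0 b); last first.
  by apply/rowP => a; rewrite mxE mulrAC minor mulfK.
apply/eqP => c0; move/eqP: (pcoord_neq0 q); apply; apply/rowP => a.
by rewrite mxE -[LHS](mulfK pb) -minor mulrAC c0 mul0r.
Qed.

Hypothesis X_distinct : forall i j, i != j -> ~ same_point (X i) (X j).

(** The product over j <> i of linear forms through X_j that avoid X_i. *)
Lemma separating_form i : exists2 E : R, cr_homog n E &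
  forall j, restr j E = if j == i then 'X^n else 0.
Proof.
have /fin_all_exists[v hv] : forall j, exists v : 'I_3 -> k,
    (j != i) -> \sum_a v a * X j 0 a = 0 /\ \sum_a v a * X i 0 a != 0.
  move=> j; have [->|ne] := eqVneq j i; first by exists (fun _ => 0).
  have [v v1 v2] : exists2 v : 'I_3 -> k,
      \sum_a v a * X j 0 a = 0 & \sum_a v a * X i 0 a != 0.
    by apply: separating_linform; apply: X_distinct; rewrite eq_sym.
  by exists v.
pose c := \prod_(j | j != i) \sum_a v j a * X i 0 a.
have c0 : c != 0 by apply/prodf_neq0 => j /hv[].
have degE : #|[pred j : 'I_n.+1 | j != i]| = n by rewrite cardC1 card_ord.
exists (cr_const X c^-1 * \prod_(j | j != i) linform (v j)).
  apply: cr_homogZ; rewrite -[n in cr_homog n _]degE -sum1_card.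
  elim/big_ind2: _ => [|d r e s|j _]; first by rewrite -cr_const1; apply: cr_homog_const.
    exact: cr_homogM.
  exact: linform_homog.
move=> j; rewrite rmorphM /= restr_const rmorph_prod /=.
have [->|ne] := eqVneq j i; last first.
  by rewrite (bigD1 j) //= restr_linform (hv j ne).1 scale0r mul0r mulr0.
under eq_bigr do rewrite restr_linform -mul_polyC.
by rewrite big_split /= prodr_const degE -rmorph_prod /= mulrA -polyCM mulVf ?mul1r.
Qed.

End SpecialForms.

(** The form x + t y + t^2 z vanishes at X_i only if t is a root of a nonzero
    polynomial of degree at most 2; over an infinite field some t avoids
    the roots of these finitely many polynomials. *)
Lemma avoiding_linform (k : closedFieldType) n (X : 'I_n.+1 -> ppoint k) :
  exists l : coord_ring X, exists a : 'I_n.+1 -> k,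
    [/\ cr_homog 1 l, forall i, a i != 0 & forall i, restr i l = a i *: 'X].
Proof.
pose q i : {poly k} := \poly_(d < 3) X i 0 (inord d).
have q0 i : q i != 0.
  apply/negP => /eqP q0; move/eqP: (pcoord_neq0 (X i)); apply; apply/rowP => a.
  by have := coef0 k a; rewrite -q0 coef_poly ltn_ord inord_val mxE.
have /closed_nonrootP[t] : \prod_i q i != 0 by apply/prodf_neq0 => i _.
rewrite /root horner_prod => /prodf_neq0 ht.
exists (linform X (fun a => t ^+ a)), (fun i => (q i).[t]).
split=> [|i|i]; [exact: linform_homog|exact: ht|].
rewrite restr_linform horner_poly; congr (_ *: _); apply: eq_bigr => a _.
by rewrite inord_val mulrC.
Qed.

(** * Graded submodules and direct sums from their components *)

Section GradedFamilies.
Variables (k : fieldType) (n : nat) (X : 'I_n.+1 -> ppoint k) (M : gmodule X).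
Implicit Types (u v w : M) (d : int) (Q : int -> M -> Prop).

Lemma gcompN d u : gcomp d u -> gcomp d (- u).
Proof. by move=> hu; rewrite -sub0r; apply: gcompB => //; apply: gcomp0. Qed.

Lemma gcompD d u v : gcomp d u -> gcomp d v -> gcomp d (u + v).
Proof. by move=> hu hv; rewrite -[v]opprK; apply: gcompB => //; apply: gcompN. Qed.

Lemma gcomp_const d c v : gcomp d v -> gcomp d (cr_const X c *: v).
Proof. by move=> hv; rewrite -[d]addr0; apply: gcompZ hv; apply: cr_homog_const. Qed.

Lemma gcompZX l d (p : nat) v :
  cr_homog 1 l -> gcomp d v -> gcomp (d + p%:Z) (l ^+ p *: v).
Proof. by move=> hl; apply: gcompZ; have := cr_homogX p hl; rewrite mul1n. Qed.

Lemma gmodule_ind (P : M -> Prop) : P 0 -> (forall u v, P u -> P v -> P (u + v)) ->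
  (forall d u, gcomp d u -> P u) -> forall u, P u.
Proof.
move=> P0 PD Pc u; have [s [c [hc ->]]] := gcomp_span u.
by elim/big_ind: _ => // d _; apply: Pc (hc d).
Qed.

Lemma regular_exp (l : coord_ring X) (p : nat) v :
  (forall w, l *: w = 0 -> w = 0) -> l ^+ p *: v = 0 -> v = 0.
Proof.
by move=> reg; elim: p v => [|p IH] v; rewrite ?scale1r // exprSr -scalerA => /IH/reg.
Qed.

(** The family of homogeneous components of a graded submodule, which is then
    recovered as [gspan Q]. *)
Definition homog_family Q :=
  [/\ forall d v, Q d v -> gcomp d v, forall d, Q d 0,
      forall d u v, Q d u -> Q d v -> Q d (u - v)
    & forall (e : nat) d r v, cr_homog e r -> Q d v -> Q (d + e%:Z) (r *: v)].

Definition gspan Q u := exists (s : seq int) (c : int -> M),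
  (forall d, Q d (c d)) /\ u = \sum_(d <- s) c d.

Section OneFamily.
Variables (Q : int -> M -> Prop) (hQ : homog_family Q).

Let Q0 d : Q d 0. Proof. by case: hQ. Qed.

Lemma homog_familyD d u v : Q d u -> Q d v -> Q d (u + v).
Proof.
case: hQ => _ _ QB _ hu hv; rewrite -[v]opprK; apply: (QB) => //.
by rewrite -sub0r; apply: QB.
Qed.

Lemma gspan_uniq u : gspan Q u -> exists (s : seq int) (c : int -> M),
  [/\ uniq s, forall d, Q d (c d), forall d, d \notin s -> c d = 0
    & u = \sum_(d <- s) c d].
Proof.
case=> s [c [hc ->]]; exists (undup s), (fun d => c d *+ count_mem d s).
split=> [|d|d|]; first exact: undup_uniq.
- elim: count => [|m IH]; first by rewrite mulr0n.
  by rewrite mulrS; apply: homog_familyD.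
- by rewrite mem_undup => /count_memPn->; rewrite mulr0n.
by rewrite -big_undup_iterop_count.
Qed.

Lemma sum_supported (s t : seq int) (c : int -> M) : uniq s -> uniq t ->
    {subset s <= t} -> (forall d, d \notin s -> c d = 0) ->
  \sum_(d <- s) c d = \sum_(d <- t) c d.
Proof.
move=> us ut st c0; rewrite [RHS](bigID (mem s)) /= [X in _ + X]big1 // addr0.
rewrite -[RHS]big_filter; apply: perm_big; apply: uniq_perm => //.
  exact: filter_uniq.
by move=> d; rewrite mem_filter; case: (boolP (d \in s)) => // /st.
Qed.

Lemma gspan_homog d u : Q d u -> gspan Q u.
Proof.
move=> hu; exists [:: d], (fun e => if e == d then u else 0).
by split=> [e|]; [case: eqP => [->|]|rewrite big_seq1 eqxx].
Qed.

End OneFamily.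

Lemma gspan_common Q1 Q2 u v : homog_family Q1 -> homog_family Q2 ->
    gspan Q1 u -> gspan Q2 v ->
  exists (s : seq int) (c1 c2 : int -> M),
    [/\ uniq s, forall d, Q1 d (c1 d), forall d, Q2 d (c2 d),
        u = \sum_(d <- s) c1 d & v = \sum_(d <- s) c2 d].
Proof.
move=> hQ1 hQ2 /(gspan_uniq hQ1)[s1 [c1 [u1 h1 z1 ->]]].
move=> /(gspan_uniq hQ2)[s2 [c2 [u2 h2 z2 ->]]].
exists (undup (s1 ++ s2)), c1, c2; split=> //; first exact: undup_uniq.
  by apply: sum_supported => // [|d ds]; rewrite ?undup_uniq // mem_undup mem_cat ds.
by apply: sum_supported => // [|d ds]; rewrite ?undup_uniq // mem_undup mem_cat ds orbT.
Qed.

Lemma gspanD Q u v : homog_family Q -> gspan Q u -> gspan Q v -> gspan Q (u + v).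
Proof.
move=> hQ hu hv; have [s [c1 [c2 [us h1 h2 -> ->]]]] := gspan_common hQ hQ hu hv.
exists s, (fun d => c1 d + c2 d); split=> [d|]; last by rewrite big_split.
exact: homog_familyD.
Qed.

Lemma gspan_submod Q : homog_family Q -> is_graded_submod (gspan Q).
Proof.
move=> hQ; have [Qc Q0 QB QZ] := hQ.
have g0 : gspan Q 0 by exists [::], (fun=> 0); rewrite big_nil.
split=> // [r u v hu hv|u [s [c [hc ->]]]]; last first.
  by exists s, c; split=> // d; split; [apply: Qc|apply: gspan_homog (hc d)].
apply: gspanD hv => //; move: r u hu.
apply: cr_homog_ind => [u|r r' hr hr' u hu|e r hr u].
- by rewrite scale0r.
- by rewrite scalerDl; apply: gspanD => //; [apply: hr|apply: hr'].
case=> s [c [hc ->]]; exists [seq d + e%:Z | d <- s], (fun d => r *: c (d - e%:Z)).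
split=> [d|]; first by have := QZ e _ _ _ hr (hc (d - e%:Z)); rewrite subrK.
by rewrite big_map scaler_sumr; apply: eq_bigr => d _; rewrite addrK.
Qed.

Lemma gspan_direct_sum Q1 Q2 : homog_family Q1 -> homog_family Q2 ->
    (forall d v, gcomp d v -> exists v1 v2, [/\ Q1 d v1, Q2 d v2 & v = v1 + v2]) ->
    (forall d v, Q1 d v -> Q2 d v -> v = 0) ->
  is_direct_sum (gspan Q1) (gspan Q2).
Proof.
move=> hQ1 hQ2 sum12 cap12; split=> [u|u hu1 hu2].
  elim/gmodule_ind: u => [|u v [u1 [u2 [h1 h2 ->]]] [v1 [v2 [g1 g2 ->]]]|d v].
  - have [[z1 _ _] [z2 _ _]] := (gspan_submod hQ1, gspan_submod hQ2).
    by exists 0, 0; rewrite addr0.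
  - by exists (u1 + v1), (u2 + v2); split; [exact: gspanD|exact: gspanD|exact: addrACA].
  move=> /sum12[v1 [v2 [h1 h2 ->]]]; exists v1, v2; split=> //.
    exact: gspan_homog h1.
  exact: gspan_homog h2.
have [s [c1 [c2 [us h1 h2 e1 e2]]]] := gspan_common hQ1 hQ2 hu1 hu2.
have c12 : forall d, d \in s -> c1 d - c2 d = 0.
  apply: (@gcomp_indep _ _ _ M s (fun d => c1 d - c2 d) us) => [d|].
    case: hQ1 hQ2 => [Qc1 _ _ _] [Qc2 _ _ _].
    by apply: gcompB; [apply: Qc1|apply: Qc2].
  by rewrite sumrB -e1 -e2 subrr.
rewrite e1 big_seq big1 // => d ds; apply: (cap12 d) => //.
by move/eqP: (c12 d ds); rewrite subr_eq0 => /eqP->.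
Qed.

(** Indecomposability can be tested degree by degree. *)
Lemma indecomposable_families Q1 Q2 : indecomposable M ->
    homog_family Q1 -> homog_family Q2 ->
    (forall d v, gcomp d v -> exists v1 v2, [/\ Q1 d v1, Q2 d v2 & v = v1 + v2]) ->
    (forall d v, Q1 d v -> Q2 d v -> v = 0) ->
  (forall d v, Q1 d v -> v = 0) \/ (forall d v, Q2 d v -> v = 0).
Proof.
move=> [_ indec] hQ1 hQ2 sum12 cap12.
case: (indec _ _ (gspan_submod hQ1) (gspan_submod hQ2)
  (gspan_direct_sum hQ1 hQ2 sum12 cap12)) => h; [left|right] => d v hv; apply: h.
- exact: gspan_homog hv.
- exact: gspan_homog hv.
Qed.

End GradedFamilies.

(** * Modules generated by one element *)

Section HomogeneousComponents.
Variables (k : fieldType) (n : nat) (X : 'I_n.+1 -> ppoint k) (M : gmodule X).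

Lemma homog_component (s : seq int) (c : int -> M) d : uniq s ->
    (forall e, gcomp e (c e)) -> (forall e, e \notin s -> c e = 0) ->
  gcomp d (\sum_(e <- s) c e) -> \sum_(e <- s) c e = c d.
Proof.
move=> us hc c0; set t := undup (d :: s); set v := \sum_(e <- s) _ => hv.
have ut : uniq t by apply: undup_uniq.
have dt : d \in t by rewrite mem_undup mem_head.
(* The family b vanishes in total, so each of its terms vanishes. *)
pose b e := c e - (if e == d then v else 0).
apply/esym/eqP; rewrite -subr_eq0; apply/eqP.
have -> : c d - v = b d by rewrite /b eqxx.
apply: (@gcomp_indep _ _ _ M t b) => // [e|].
  by apply: gcompB => //; case: eqP => [->|_] //; apply: gcomp0.
rewrite sumrB -(@sum_supported _ _ _ M s t) // => [|e es]; last first.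
  by rewrite mem_undup in_cons es orbT.
rewrite [X in _ - X](_ : _ = v) ?subrr // (bigD1_seq d) //= eqxx.
by rewrite [X in _ + X]big1 ?addr0 // => e /negPf->.
Qed.

Lemma gcomp_of_span (Q : int -> M -> Prop) d v :
  homog_family Q -> gspan Q v -> gcomp d v -> Q d v.
Proof.
move=> hQ /(gspan_uniq hQ)[s [c [us hc c0 ->]]] hv.
rewrite (homog_component us _ c0 hv) // => e.
by case: hQ => + _ _ _; apply.
Qed.

Lemma homog_family_gcomp : homog_family (@gcomp _ _ _ M).
Proof.
by split; [|exact: gcomp0|exact: gcompB|move=> *; apply: gcompZ].
Qed.

End HomogeneousComponents.

Section CyclicLine.
Variables (k : fieldType) (n : nat) (X : 'I_n.+1 -> ppoint k) (i : 'I_n.+1).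
Local Notation R := (coord_ring X).
Variables (l : R) (a : k).
Hypotheses (hl : cr_homog 1 l) (a0 : a != 0) (restr_l : restr i l = a *: 'X).

Lemma restr_scaleX c p : restr i (cr_const X c * l ^+ p) = (c * a ^+ p) *: 'X^p.
Proof. by rewrite rmorphM rmorphXn /= restr_const restr_l exprZn mul_polyC scalerA. Qed.

Variables (M : gmodule X) (d0 : int) (u : M).
Hypotheses (hu : gcomp d0 u) (killed : forall r : R, restr i r = 0 -> r *: u = 0).

(** The components of k[l] u; the first disjunct supplies 0 in the degrees
    below d0. *)
Definition line_family (d : int) (v : M) :=
  v = 0 \/ exists (p : nat) (c : k), d = d0 + p%:Z /\ v = cr_const X c *: (l ^+ p *: u).

Lemma scale_eq (r s : R) : restr i r = restr i s -> r *: u = s *: u.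
Proof.
move=> e; apply/eqP; rewrite -subr_eq0 -scalerBl; apply/eqP/killed.
by rewrite raddfB /= e subrr.
Qed.

(** An element r of degree e acts on k[l] u as r(X_i) / l(X_i)^e times l^e,
    because both have the same restriction to X_i. *)
Lemma line_family_homog : homog_family line_family.
Proof.
split.
- move=> d v [->|[p [c [-> ->]]]]; first exact: gcomp0.
  by apply: gcomp_const; apply: gcompZX.
- by move=> d; left.
- move=> d v w [->|[p [c [-> ->]]]] [->|[q [c' [e ->]]]]; first by left; rewrite subr0.
  + right; exists q, (- c'); split=> //.
    by rewrite -[- c']sub0r cr_constB cr_const0 !sub0r scaleNr.
  + by right; exists p, c; rewrite subr0.
  right; exists p, (c - c'); split=> //; move/addrI: e => [<-].
  by rewrite cr_constB scalerBl.
move=> e d r v hr [->|[p [c [-> ->]]]]; first by left; rewrite scaler0.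
have [b hb] := restr_homog i hr.
right; exists (p + e)%N, (c * b / a ^+ e); split; first by rewrite PoszD addrA.
rewrite !scalerA; apply: scale_eq.
rewrite -mulrA [LHS]rmorphM /= restr_scaleX hb restr_scaleX.
rewrite -scalerAl -scalerAr scalerA -exprD addnC; congr (_ *: _).
by rewrite exprD [a ^+ p * _]mulrC !mulrA mulfVK ?expf_neq0 // [b * c]mulrC.
Qed.

Lemma line_family_span (r : R) : gspan line_family (r *: u).
Proof.
have [z lin _] := gspan_submod line_family_homog.
rewrite -[r *: u]addr0; apply: lin => //.
apply: (@gspan_homog _ _ _ _ _ line_family_homog d0).
by right; exists 0%N, 1; rewrite cr_const1 !scale1r addr0.
Qed.

Lemma line_gcomp d v : (forall w : M, exists r, w = r *: u) ->
  gcomp d v -> line_family d v.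
Proof.
move=> gen; apply: gcomp_of_span; first exact: line_family_homog.
by have [r ->] := gen v; apply: line_family_span.
Qed.

(** If r u = 0, each homogeneous component of r kills u; that component acts on
    u as a scalar times a power of l, and the power of l is injective. *)
Lemma line_ann (r : R) : (forall v : M, l *: v = 0 -> v = 0) -> u <> 0 ->
  r *: u = 0 -> restr i r = 0.
Proof.
move=> reg_l u0; pose f := cr_repr r; pose N := mmeasure mdeg f.
pose rc e : R := cr_proj X (pihomog mdeg e f).
have rc_homog e : cr_homog e (rc e) by exists (pihomog mdeg e f) => //; apply: pihomogP.
have er : r = \sum_(e < N) rc e.
  by rewrite -[LHS]cr_reprK -/f [in LHS](pihomog_partitionE (leqnn N)) raddf_sum.
pose s := [seq d0 + e%:Z | e <- iota 0 N].
have us : uniq s by rewrite map_inj_uniq ?iota_uniq // => e e' /addrI[].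
pose c (d : int) : M := if (d0 <= d)%R then rc (absz (d - d0)) *: u else 0.
have cE (e : nat) : c (d0 + e%:Z) = rc e *: u.
  by rewrite /c lerDl lez_nat addrC addKr.
have hc d : gcomp d (c d).
  rewrite /c; case: ifP => [le|_]; last exact: gcomp0.
  by have := gcompZ (rc_homog (absz (d - d0))) hu; congr gcomp; lia.
move=> ru0; have sum0 : \sum_(d <- s) c d = 0.
  rewrite -[RHS]ru0 er scaler_suml /s big_map -[N in iota 0 N]subn0 big_mkord.
  by apply: eq_bigr => e _; rewrite cE.
rewrite er raddf_sum /= big1 // => -[e /= lt_e] _.
have [b hb] := restr_homog i (rc_homog e); rewrite hb.
have rcu0 : rc e *: u = 0.
  rewrite -cE; apply: (gcomp_indep us hc sum0).
  by apply: map_f; rewrite mem_iota.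
suff -> : b = 0 by rewrite scale0r.
apply/eqP/negPn/negP => b0; apply: u0.
have /(regular_exp reg_l) cu0 : l ^+ e *: (cr_const X (b / a ^+ e) *: u) = 0.
  rewrite scalerA -rcu0; apply: scale_eq.
  by rewrite mulrC restr_scaleX hb divfK // expf_neq0.
have c0 : b / a ^+ e != 0 by rewrite mulf_neq0 // invr_neq0 // expf_neq0.
by rewrite -[u]scale1r -cr_const1 -(mulVf c0) cr_constM -scalerA cu0 scaler0.
Qed.

End CyclicLine.

Section PointModules.
Variables (k : fieldType) (n : nat) (X : 'I_n.+1 -> ppoint k) (i : 'I_n.+1).
Local Notation R := (coord_ring X).
Local Notation L := (point_module X i).
Variable M : gmodule X.

(** Up to a shift, the modules with such a generator are the point module:
    see [giso_generator] and [generator_giso]. *)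
Definition point_generator (d : int) (u : M) :=
  [/\ gcomp d u, forall v : M, exists r : R, v = r *: u
    & forall r : R, r *: u = 0 <-> restr i r = 0].

Lemma quot_scale1r (r : R) :
  r *: (1 : quot_carrier (@point_idealR k n X i)) = quot_proj _ r :> quot_module _.
Proof. exact: mulr1. Qed.

Lemma giso_generator s : giso M (gshift L s) -> exists u, point_generator (- s) u.
Proof.
case=> f [[g fK gK] grf].
pose y : gshift L s := (1 : quot_carrier (@point_idealR k n X i)).
have fg r : f (r *: g y) = quot_proj _ r by rewrite linearZ /= gK; apply: quot_scale1r.
exists (g y); split=> [|v|r].
- apply/grf; rewrite gK /= /shift_comp addNr /=; exists 1; last by rewrite rmorph1.
  by rewrite -cr_const1; apply: cr_homog_const.
- have [r er] := quot_proj_surj (f v : quot_carrier _).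
  by exists r; apply: (can_inj fK); rewrite fg er.
have -> : r *: g y = 0 <-> quot_proj (@point_idealR k n X i) r = 0.
  by rewrite -fg; split=> [->|e]; [rewrite raddf0|apply: (can_inj fK); rewrite raddf0].
split=> [/eqP|/eqP e]; first by rewrite quot_proj_eq0 point_ideal_restr => /eqP.
by apply/eqP; rewrite quot_proj_eq0 point_ideal_restr.
Qed.

(** The map r u |-> r is a well defined linear bijection onto R / I(X_i), and it
    carries components into components in the reverse direction.  As both sides
    are direct sums of their components, this already makes it an isomorphism
    of graded modules. *)
Lemma generator_giso s u : point_generator (- s) u -> giso M (gshift L s).
Proof.
case=> hu gen ann; have [rho hrho] := functional_choice _ gen.
pose f (v : M) : gshift L s := quot_proj _ (rho v).
have fE r v : v = r *: u -> f v = quot_proj _ r.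
  move=> e; apply/eqP; rewrite -subr_eq0 -raddfB quot_proj_eq0 point_ideal_restr.
  by apply/eqP/ann; rewrite scalerBl -hrho e subrr.
have flin : linear f.
  move=> r v w; rewrite (fE (r * rho v + rho w)).
    by apply: etrans (raddfD _ _ _) _; congr (_ + _); apply: rmorphM.
  by rewrite scalerDl -scalerA -!hrho.
pose F : {linear M -> gshift L s} := HB.pack f (GRing.isLinear.Build _ _ _ _ f flin).
have finj v : f v = 0 -> v = 0.
  move=> /eqP; rewrite /f quot_proj_eq0 point_ideal_restr => /eqP/ann.
  by rewrite -hrho.
have fsurj d y : point_comp d y -> exists w, gcomp (d - s) w /\ f w = y.
  case: d => [d|d] /=; last first.
    by move=> ->; exists 0; split; [apply: gcomp0|rewrite -[f]/(F : _ -> _) raddf0].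
  case=> r hr ->; exists (r *: u); split; last exact: fE.
  by rewrite addrC; apply: gcompZ.
exists F; split.
  have [g hg] : exists g : gshift L s -> M, forall y, f (g y) = y.
    apply: (functional_choice (fun y v => f v = y)) => y.
    have [r ->] := quot_proj_surj (y : quot_carrier _).
    by exists (r *: u); apply: fE.
  exists g => [v|y]; last exact: hg.
  apply/eqP; rewrite -subr_eq0; apply/eqP/finj.
  by rewrite -[f]/(F : _ -> _) raddfB /= hg subrr.
move=> d v; split=> [hv|].
  have hL := homog_family_gcomp L.
  have [t [c [ht hc]]] := @gcomp_span _ _ _ L (f v).
  have /(gspan_uniq hL)[{}t [{}c [ut {}ht c0 {}hc]]] : gspan (@gcomp _ _ _ L) (f v).
    by exists t, c.
  have [w hw] := functional_choice _ (fun e => fsurj e _ (ht e)).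
  (* Lifting the components of f v gives components of v. *)
  have ew : v = \sum_(e <- [seq e - s | e <- t]) w (e + s).
    apply/eqP; rewrite -subr_eq0; apply/eqP/finj.
    rewrite -[f]/(F : _ -> _) raddfB big_map raddf_sum /= hc -sumrB big1 // => e _.
    by rewrite subrK (hw e).2 subrr.
  have -> : v = w (d + s).
    rewrite [LHS]ew; apply: (@homog_component _ _ _ _ _ (fun e => w (e + s))).
    - by rewrite map_inj_uniq //; apply: addIr.
    - by move=> e; have := (hw (e + s)).1; rewrite addrK.
    - move=> e es; apply: finj; rewrite (hw _).2 c0 //.
      by apply: contra es => es; rewrite -[e](addrK s); apply: map_f.
    by rewrite -ew.
  by rewrite /= /shift_comp (hw _).2; apply: ht.
move=> /fsurj[w [hw ew]]; have -> : v = w.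
  apply/eqP; rewrite -subr_eq0; apply/eqP/finj.
  by rewrite -[f]/(F : _ -> _) raddfB /= ew subrr.
by rewrite addrK in hw.
Qed.

End PointModules.

(** * Point modules are Ulrich and indecomposable *)

Section PointGeneratorUlrich.
Variables (k : fieldType) (n : nat) (X : 'I_n.+1 -> ppoint k) (i : 'I_n.+1).
Local Notation R := (coord_ring X).
Variables (l : R) (a : k).
Hypotheses (hl : cr_homog 1 l) (a0 : a != 0) (restr_l : restr i l = a *: 'X).
Variables (M : gmodule X) (d0 : int) (u : M).
Hypothesis gen_u : point_generator i d0 u.

Let hu : gcomp d0 u. Proof. by case: gen_u. Qed.
Let gen (v : M) : exists r : R, v = r *: u. Proof. by case: gen_u. Qed.
Let ann (r : R) : r *: u = 0 <-> restr i r = 0. Proof. by case: gen_u. Qed.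

Lemma generator_neq0 : u <> 0.
Proof.
move=> u0; have /ann : 1 *: u = 0 by rewrite u0 scaler0.
by rewrite rmorph1 => /eqP; rewrite oner_eq0.
Qed.

(** If r u and s u are nonzero elements of two complementary submodules, then
    r s u lies in both, hence is 0, against the primality of the ideal of
    X_i. *)
Lemma generator_indecomposable : indecomposable M.
Proof.
split=> [|N P [N0 Nlin _] [P0 Plin _] [_ NP0]];
  first by exists u; apply: generator_neq0.
case: (classic (forall v, N v -> v = 0)) => [|hN]; first by left.
right=> w Pw; apply: NNPP => w0; apply: hN => v Nv; apply: NNPP => v0.
have [[r er] [s es]] := (gen v, gen w).
have /ann : (r * s) *: u = 0.
  apply: NP0; last by rewrite -scalerA -es -[_ *: _]addr0; apply: Plin.
  by rewrite mulrC -scalerA -er -[_ *: _]addr0; apply: Nlin.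
rewrite rmorphM /= => /eqP; rewrite mulf_eq0 => /orP[] /eqP/ann.
  by rewrite -er.
by rewrite -es.
Qed.

Lemma generator_MCM : is_MCM M.
Proof.
split.
  exists 1%N, (fun _ => u) => v; have [r ->] := gen v.
  by exists (fun _ => r); rewrite big_ord1.
exists [:: l]; split=> // [r|]; first by rewrite inE => /eqP->; exists 1%N.
split=> [[|//] _ v [w]|]; rewrite ?big_ord0 /=.
  have [r ->] := gen v; rewrite scalerA => /ann; rewrite rmorphM /= restr_l => /eqP.
  rewrite mulf_eq0 scaler_eq0 polyX_eq0 (negPf a0) /= => /eqP/ann->.
  by exists (fun _ => 0); rewrite big_ord0.
exists u => -[w]; rewrite big_ord1 /=; have [r ->] := gen (w ord0).
rewrite scalerA => /eqP; rewrite -subr_eq0 -[X in X - _]scale1r -scalerBl => /eqP/ann.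
move=> /(congr1 (horner^~ 0)) /eqP.
rewrite raddfB /= rmorph1 rmorphM /= restr_l !hornerE.
by rewrite ?mulr0 ?mul0r ?subr0 ?oppr0 ?addr0 oner_eq0.
Qed.

Lemma generator_comp_dim d : comp_dim M d (d0 <= d)%R.
Proof.
have line := @line_gcomp _ _ _ _ _ _ hl a0 restr_l _ _ _ hu (fun r => (ann r).2) d _ gen.
have [led|ltd] := leP d0 d; last first.
  exists (fun _ => 0); split=> [j|v /line[->|[p [c [e _]]]]]; first exact: gcomp0.
    exists [ffun=> 0]; split=> [|c _]; first by rewrite big_ord0.
    by apply/ffunP => -[].
  by lia.
pose p := `|d - d0|%N; have ed : d = d0 + p%:Z by lia.
exists (fun _ => l ^+ p *: u); split=> [_|v /line hv].
  by rewrite ed; apply: gcompZX.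
have {hv}[c ->] : exists c, v = cr_const X c *: (l ^+ p *: u).
  case: hv => [->|[q [c [eq ->]]]]; first by exists 0; rewrite cr_const0 scale0r.
  by exists c; have -> : p = q by lia.
exists [ffun=> c]; split=> [|b]; first by rewrite big_ord1 ffunE.
rewrite big_ord1 => /eqP; rewrite -subr_eq0 -scalerBl -cr_constB scalerA.
move=> /eqP/ann; rewrite (restr_scaleX restr_l) => /eqP.
rewrite scaler_eq0 (negPf (monic_neq0 (monicXn k p))) mulf_eq0 expf_eq0.
rewrite (negPf a0) andbF !orbF subr_eq0.
by move=> /eqP cb; apply/ffunP => j; rewrite ffunE (ord1 j) cb.
Qed.

Lemma generator_Ulrich : is_Ulrich M.
Proof.
split; first exact: generator_MCM.
exists 1%N; split.
  split=> [|[|//] g hg].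
    exists (fun _ => u) => v; have [r ->] := gen v.
    by exists (fun _ => r); rewrite big_ord1.
  by have [b] := hg u; rewrite big_ord0 => /generator_neq0.
exists d0, 1; split; last by rewrite hornerC.
exists (fun d => (d0 <= d)%R : nat); split=> [d|d]; first exact: generator_comp_dim.
case: ifP => // _; rewrite big_ord_recl /= coef1 big1 ?addr0 // => j _.
by rewrite coef1.
Qed.

End PointGeneratorUlrich.

(** * Coordinates in the components, and sets of generators *)

Section Frames.
Variables (k : fieldType) (n : nat) (X : 'I_n.+1 -> ppoint k) (M : gmodule X).
Local Notation R := (coord_ring X).
Local Notation "c ^%" := (cr_const X c) (at level 2, format "c ^%").

Definition frame (d : int) (h : nat) (T : 'rV[k]_h -> M) :=
  [/\ forall c x y, T (c *: x + y) = c^% *: T x + T y, forall x, gcomp d (T x),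
      forall v, gcomp d v -> exists x, v = T x & injective T].

Lemma comp_dim_frame d h : comp_dim M d h -> exists T : 'rV[k]_h -> M, frame d T.
Proof.
case=> b [hb uniq_b]; pose T (x : 'rV[k]_h) := \sum_j (x 0 j)^% *: b j.
have Td x : gcomp d (T x).
  rewrite /T; elim/big_ind: _ => [|v w|j _].
  - exact: gcomp0.
  - exact: gcompD.
  - exact: gcomp_const.
exists T; split=> // [c x y|v hv|x y exy].
- rewrite scaler_sumr -big_split; apply: eq_bigr => j _ /=.
  by rewrite !mxE cr_constD cr_constM scalerDl scalerA.
- have [c [ec _]] := uniq_b v hv; exists (\row_j c j).
  by rewrite ec; apply: eq_bigr => j _; rewrite mxE.
have [c [_ uc]] := uniq_b (T x) (Td x).
have ex : c = [ffun j => x 0 j].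
  by apply: uc; apply: eq_bigr => j _; rewrite ffunE.
have ey : c = [ffun j => y 0 j].
  by apply: uc; rewrite exy; apply: eq_bigr => j _; rewrite ffunE.
by apply/rowP => j; have := congr1 (fun f : {ffun _ -> _} => f j) (etrans (esym ex) ey);
  rewrite !ffunE.
Qed.

Section OneFrame.
Variables (d : int) (h : nat) (T : 'rV[k]_h -> M).
Hypothesis hT : frame d T.

Lemma frame0 : T 0 = 0.
Proof.
case: hT => lin _ _ _; have := lin 1 0 0; rewrite scaler0 addr0 cr_const1 scale1r.
by rewrite -{1}[T 0]addr0 => /addrI.
Qed.

Lemma frameZ c x : T (c *: x) = c^% *: T x.
Proof. by case: hT => lin _ _ _; rewrite -[c *: x]addr0 lin frame0 addr0. Qed.

Lemma frameD x y : T (x + y) = T x + T y.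
Proof. by case: hT => lin _ _ _; rewrite -[x]scale1r lin cr_const1 !scale1r. Qed.

Lemma frameB x y : T (x - y) = T x - T y.
Proof. by apply/eqP; rewrite eq_sym subr_eq -frameD subrK. Qed.

Lemma frame_mulmx p (x : 'rV[k]_p) (W : 'M[k]_(p, h)) :
  T (x *m W) = \sum_j (x 0 j)^% *: T (row j W).
Proof.
rewrite mulmx_sum_row; elim/big_rec2: _ => [|j v y _ <-]; first exact: frame0.
by rewrite frameD frameZ.
Qed.

End OneFrame.

Lemma mul_matrix d (e : nat) h h' (T : 'rV[k]_h -> M) (T' : 'rV[k]_h' -> M) r :
    frame d T -> frame (d + e%:Z) T' -> cr_homog e r ->
  exists A : 'M[k]_(h, h'), forall x, r *: T x = T' (x *m A).
Proof.
move=> hT hT' hr; have [_ Td _ _] := hT; have [_ _ T'surj _] := hT'.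
have /fin_all_exists[y hy] : forall j, exists y, r *: T (delta_mx 0 j) = T' y.
  by move=> j; apply: T'surj; apply: gcompZ.
exists (\matrix_j y j) => x; rewrite (frame_mulmx hT') -[x in LHS]mulmx1.
rewrite (frame_mulmx hT) scaler_sumr; apply: eq_bigr => j _.
by rewrite row1 rowK -hy !scalerA mulrC.
Qed.

Definition spanned s (g : 'I_s -> M) v := exists c : 'I_s -> R, v = \sum_j c j *: g j.

Lemma spannedD s (g : 'I_s -> M) v w : spanned g v -> spanned g w -> spanned g (v + w).
Proof.
move=> [c ->] [c' ->]; exists (fun j => c j + c' j); rewrite -big_split.
by apply: eq_bigr => j _; rewrite scalerDl.
Qed.

Lemma spannedZ s (g : 'I_s -> M) r v : spanned g v -> spanned g (r *: v).
Proof.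
move=> [c ->]; exists (fun j => r * c j); rewrite scaler_sumr.
by apply: eq_bigr => j _; rewrite scalerA.
Qed.

Lemma spanned0 s (g : 'I_s -> M) : spanned g 0.
Proof. by exists (fun=> 0); rewrite big1 // => j _; rewrite scale0r. Qed.

Lemma spanned_sum s (g : 'I_s -> M) (I : finType) (F : I -> M) :
  (forall j, spanned g (F j)) -> spanned g (\sum_j F j).
Proof.
by move=> hF; elim/big_ind: _ => // [|v w]; [apply: spanned0|apply: spannedD].
Qed.

Lemma spanned_gen s (g : 'I_s -> M) j : spanned g (g j).
Proof.
exists (fun i => (i == j)%:R); rewrite (bigD1 j) //= eqxx scale1r big1 ?addr0 //.
by move=> i /negPf->; rewrite scale0r.
Qed.

Definition generated_upto d s := exists g : 'I_s -> M,
  forall e v, (e <= d)%R -> gcomp e v -> spanned g v.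

(** The rows of W give independent elements of M_(d+1) that are generated from
    lower degrees; only a complement of their span, of dimension h - p, requires
    new generators. *)
Lemma extend_generators d s p h (T : 'rV[k]_h -> M) (W : 'M[k]_(p, h)) :
    frame (d + 1) T -> row_free W -> generated_upto d s ->
    (forall j, exists r v, gcomp d v /\ T (row j W) = r *: v) ->
  (p <= h)%N /\ generated_upto (d + 1) (s + (h - p)).
Proof.
move=> hT Wfree [g hg] hW; have [_ _ Tsurj _] := hT.
have rW : \rank W = p by apply/eqP.
split; first by rewrite -rW rank_leq_col.
(* The new generators are a basis of the complement of the row space of W. *)
rewrite -[p in (h - p)%N]rW -mxrank_compl; set C := row_base (W^C)%MS.
pose g' (j : 'I_(s + _)) := match split j with inl i => g i | inr i => T (row i C) end.
exists g' => e v led hv.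
have sub w : spanned g w -> spanned g' w.
  case=> c ->; apply: spanned_sum => j; apply: spannedZ.
  by have := spanned_gen g' (lshift _ j); rewrite /g' (unsplitK (inl j)).
have [{}led|ltd] := leP e d; first by apply: sub; apply: hg hv.
have {led ltd} ee : e = d + 1 by lia.
move: hv; rewrite ee => /Tsurj[x ->].
have [[y z] /= ->] : exists yz, x = yz.1 *m W + yz.2 *m C.
  apply/sub_addsmxP; rewrite (adds_eqmx (eqmx_refl W) (eq_row_base _)).
  by apply: submx_full; apply: addsmx_compl_full.
rewrite (frameD hT) !(frame_mulmx hT); apply: spannedD; apply: spanned_sum => j.
  apply/sub/spannedZ; have [r [w [hw ->]]] := hW j.
  by apply/spannedZ/(hg d).
apply: spannedZ; have := spanned_gen g' (rshift _ j).
by rewrite /g' (unsplitK (inr j)).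
Qed.

End Frames.

(** * Linear forms act on an Ulrich module as multiples of a regular one *)

Section GeneratorCount.
Variables (k : fieldType) (n : nat) (X : 'I_n.+1 -> ppoint k) (M : gmodule X).
Local Notation R := (coord_ring X).
Implicit Types (d e : int) (u v w : M).
Variables (l : R) (hl : cr_homog 1 l) (reg_l : forall v : M, l *: v = 0 -> v = 0).
Variables (h : int -> nat) (dim_h : forall d, comp_dim M d (h d)).
Variables (a D : int) (m : nat).
Hypotheses (h_low : forall d, d < a -> h d = 0%N) (h_high : forall d, D <= d -> h d = m).

Lemma gcomp_dim0 d v : h d = 0%N -> gcomp d v -> v = 0.
Proof.
move=> hd; have [b [_ uniq_b]] := dim_h d; move: b uniq_b; rewrite hd => b ub.
by move=> /ub[c [-> _]]; rewrite big_ord0.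
Qed.

Lemma mul_l_matrix d (T : 'rV[k]_(h d) -> M) (T' : 'rV[k]_(h (d + 1)) -> M) :
  frame d T -> frame (d + 1) T' ->
  exists2 A : 'M[k]_(h d, h (d + 1)), forall x, l *: T x = T' (x *m A) & row_free A.
Proof.
move=> hT hT'; have [A hA] := mul_matrix hT hT' hl; exists A => //.
apply: inj_row_free => x xA; have [_ _ _] := hT; apply.
by rewrite (frame0 hT); apply: reg_l; rewrite hA xA (frame0 hT').
Qed.

(** Multiplication by l is an injective map between spaces of the same
    dimension m. *)
Lemma divide_high d v : D <= d -> gcomp (d + 1) v -> exists2 w, gcomp d w & v = l *: w.
Proof.
move=> led hv; have [T hT] := comp_dim_frame (dim_h d).
have [T' hT'] := comp_dim_frame (dim_h (d + 1)).
have [A hA Afree] := mul_l_matrix hT hT'.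
have [_ _ /(_ v hv)[y ->] _] := hT'.
have /submxP[x ->] : (y <= A)%MS.
  apply: submx_full; rewrite /row_full (eqP Afree) !h_high //; lia.
by exists (T x); [case: hT|rewrite hA].
Qed.

Lemma divide_highX p d v : D <= d -> gcomp (d + p%:Z) v ->
  exists2 w, gcomp d w & v = l ^+ p *: w.
Proof.
move=> led; elim: p v => [|p IH] v; first by rewrite addr0; exists v; rewrite ?scale1r.
rewrite -addn1 PoszD addrA => /divide_high[|w /IH[z hz ->] ->]; first by lia.
by exists z; rewrite // scalerA -exprS addn1.
Qed.

(** The invariant of the count of generators: a surplus b passes to all higher
    degrees, and b = 1 is reached when a product of a linear form and an element
    of M_d leaves l M_d. *)
Definition few_generators d b := exists2 s, generated_upto M d s & (s + b <= h d)%N.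

Lemma few_generators_low : few_generators (a - 1) 0.
Proof.
exists 0%N => //; exists (fun _ => 0) => e v led hv.
by rewrite (@gcomp_dim0 e v) //; [apply: spanned0|apply: h_low; lia].
Qed.

Lemma few_generators_step d b : few_generators d b -> few_generators (d + 1) b.
Proof.
case=> s gen_s le_s; have [T hT] := comp_dim_frame (dim_h d).
have [T' hT'] := comp_dim_frame (dim_h (d + 1)).
have [A hA Afree] := mul_l_matrix hT hT'.
have [|le_h gen] := extend_generators hT' Afree gen_s; last first.
  by exists (s + (h (d + 1) - h d))%N => //; lia.
move=> j; exists l, (T (delta_mx 0 j)); split; first by case: hT.
by rewrite hA rowE.
Qed.

Lemma few_generators_iter d b (p : nat) :
  few_generators d b -> few_generators (d + p%:Z) b.
Proof.
elim: p => [|p IH]; first by rewrite addr0.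
by move=> /IH/few_generators_step; rewrite -addrA -PoszD addn1.
Qed.

(** Such a product r v is independent of l M_d, and it is generated by M_d: the
    passage to degree d + 1 then takes one new generator fewer than
    dim M_(d+1) - dim M_d. *)
Lemma few_generators_gain d r v : cr_homog 1 r -> gcomp d v ->
    ~ (exists2 w, gcomp d w & r *: v = l *: w) ->
  few_generators d 0 -> few_generators (d + 1) 1.
Proof.
move=> hr hv not_div [s gen_s le_s]; have [T hT] := comp_dim_frame (dim_h d).
have [T' hT'] := comp_dim_frame (dim_h (d + 1)).
have [A hA Afree] := mul_l_matrix hT hT'.
have [y ey] : exists y, r *: v = T' y by case: hT' => _ _ + _; apply; apply: gcompZ.
have Wfree : row_free (col_mx A y).
  apply: inj_row_free => x; rewrite -[x]hsubmxK mul_row_col => xW.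
  (* A relation with a nonzero coefficient at y would put r v in l M_d. *)
  have x20 : rsubmx x = 0.
    apply/rowP => j; rewrite (ord1 j) [RHS]mxE; apply/eqP/negPn/negP => c0.
    apply: not_div; exists (T (- ((rsubmx x) 0 0)^-1 *: lsubmx x)); first by case: hT.
    rewrite hA ey -scalemxAl; congr T'; apply: (scalerI c0).
    rewrite scalerA mulrN divff // scaleN1r; apply/eqP.
    by rewrite -addr_eq0 [X in X == 0]addrC -mul_scalar_mx -mx11_scalar xW.
  move: xW; rewrite x20 mul0mx addr0 => /eqP; rewrite mulmx_free_eq0 // => /eqP->.
  exact: row_mx0.
have [|le_h gen] := extend_generators hT' Wfree gen_s; last first.
  by exists (s + (h (d + 1)%R - (h d + 1)))%N => //; lia.
move=> j; rewrite -[j]splitK; case: (split j) => i /=.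
  rewrite rowKu; exists l, (T (delta_mx 0 i)); split; first by case: hT.
  by rewrite hA rowE.
by rewrite rowKd row_id -ey; exists r, v.
Qed.

Hypothesis min_m : forall s (g : 'I_s -> M), generates g -> (m <= s)%N.

(** Otherwise the generator saved in degree d + 1 would remain saved in all
    higher degrees, up to a degree from which l M_e = M_(e+1); then M would have
    a set of m - 1 generators. *)
Lemma Ulrich_divide d r v : cr_homog 1 r -> gcomp d v ->
  exists2 w, gcomp d w & r *: v = l *: w.
Proof.
move=> hr hv; apply: NNPP => not_div.
have [lta|lea] := ltP d a.
  apply: not_div; exists 0; rewrite ?(gcomp_dim0 (h_low lta) hv) ?scaler0 //.
  exact: gcomp0.
have fg : few_generators d 0.
  have <- : a - 1 + (absz (d - a + 1))%:Z = d by lia.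
  exact: few_generators_iter few_generators_low.
have [s gen_s] : few_generators (d + 1 + `|D - d|%N%:Z) 1.
  by apply: few_generators_iter; exact: few_generators_gain hr hv not_div fg.
rewrite h_high; last by lia.
case: gen_s => g hg les; suff /min_m : generates g by lia.
elim/gmodule_ind=> [|u w|e u hu]; [exact: spanned0|exact: spannedD|].
have [lee|/ltW lee] := leP e (d + 1 + `|D - d|%N%:Z); first exact: hg hu.
set b := d + 1 + _ in lee hg; have eb : e = b + `|e - b|%N%:Z by lia.
move: hu; rewrite eb => /divide_highX[|w hw ->]; first by lia.
by apply: spannedZ; apply: hg hw.
Qed.

Lemma Ulrich_divideX p d r v : cr_homog p r -> gcomp d v ->
  exists2 w, gcomp d w & r *: v = l ^+ p *: w.
Proof.
move=> hr; move: p r hr d v.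
apply: (@standard_graded _ _ X (fun p (r : R) => forall d v, gcomp d v ->
  exists2 w, gcomp d w & r *: v = l ^+ p *: w)).
- by move=> p d v _; exists 0; rewrite ?scale0r ?scaler0 //; apply: gcomp0.
- move=> p r s hr hs d v hv; have [w hw ew] := hr d v hv; have [z hz ez] := hs d v hv.
  by exists (w + z); [apply: gcompD|rewrite scalerDl scalerDr ew ez].
- by move=> c d v hv; exists (cr_const X c *: v); [apply: gcomp_const|rewrite scale1r].
- move=> p q r s hr hs d v /hs[w /hr[z hz ez] ew]; exists z => //.
  by rewrite -scalerA ew scalerA mulrC -scalerA ez scalerA exprD mulrC.
- by move=> r hr d v hv; apply: Ulrich_divide.
Qed.

End GeneratorCount.

(** * An indecomposable Ulrich module has a generator killed by a point ideal *)

Section UlrichGenerator.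
Variables (k : fieldType) (n : nat) (X : 'I_n.+1 -> ppoint k).
Local Notation R := (coord_ring X).
Local Notation "c ^%" := (cr_const X c) (at level 2, format "c ^%").
Implicit Types (d : int).

Variables (l : R) (a : 'I_n.+1 -> k) (E : 'I_n.+1 -> R).
Hypotheses (hl : cr_homog 1 l) (a_neq0 : forall i, a i != 0)
  (restr_l : forall i, restr i l = a i *: 'X)
  (hE : forall i, cr_homog n (E i))
  (restr_E : forall i j, restr j (E i) = if j == i then restr i (l ^+ n) else 0).

Lemma restr_sumE j (F : 'I_n.+1 -> R) :
  restr j (\sum_i F i * E i) = restr j (F j * l ^+ n).
Proof.
rewrite raddf_sum (bigD1 j) //= big1 ?addr0 => [|i ne].
  by rewrite !rmorphM /= restr_E eqxx.
by rewrite rmorphM /= restr_E eq_sym (negPf ne) mulr0.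
Qed.

Lemma sum_E : \sum_i E i = l ^+ n.
Proof.
apply: restr_inj => j; rewrite -[l ^+ n]mul1r -(restr_sumE j (fun=> 1)).
by congr (restr j _); apply: eq_bigr => i _; rewrite mul1r.
Qed.

Lemma mul_E i r s : restr i r = restr i s -> r * E i = s * E i.
Proof.
move=> ers; apply: restr_inj => j; rewrite !rmorphM /= restr_E.
by case: eqP => [->|_]; rewrite ?ers ?mulr0.
Qed.

(** Some homogeneous r of degree e > 0 is regular on M.  Its power
    r^(n+1) restricts to multiples of t^(e (n+1)), so it is a combination of the
    products l^(e (n+1) - n) E_i, and these are multiples of l. *)
Lemma MCM_regular (M : gmodule X) : is_MCM M -> forall v : M, l *: v = 0 -> v = 0.
Proof.
case=> _ [rs [size_rs pos_rs [reg_rs _]]] v lv0.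
case: rs => [|r [|r' rs]] // in size_rs pos_rs reg_rs *.
have [e e_gt0 hr] := pos_rs r (mem_head _ _).
have reg_r (w : M) : r *: w = 0 -> w = 0.
  move=> rw0; have [|x ->] := reg_rs 0%N isT w; last by rewrite big_ord0.
  by exists (fun _ => 0); rewrite big_ord0.
apply: (@regular_exp _ _ _ _ r n.+1) => //.
have /fin_all_exists[c hc] : forall i, exists c, restr i r = c *: 'X^e.
  by move=> i; apply: restr_homog.
pose q := (e * n.+1 - n.+1)%N.
have eq : (e * n.+1 = (q + n).+1)%N by rewrite /q; nia.
(* The scalar makes both sides have the same restriction to X_i. *)
pose b i := (c i ^+ n.+1 / a i ^+ (e * n.+1))^% * l ^+ q.
have -> : r ^+ n.+1 = (\sum_i b i * E i) * l.
  apply: restr_inj => j; rewrite [RHS]rmorphM /= restr_sumE -rmorphM /=.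
  rewrite /b -!mulrA -exprSr -exprD addnS -eq (restr_scaleX (restr_l j)).
  by rewrite mulfVK ?expf_neq0 // rmorphXn /= hc exprZn -exprM.
by rewrite -scalerA lv0 scaler0.
Qed.

Section Splitting.
Variables (M : gmodule X) (d0 : int) (m q : nat) (u : M).
Variables (i : 'I_n.+1) (T : 'rV[k]_m -> M) (x0 : 'rV[k]_m) (j : 'I_m).
Hypotheses (reg_l : forall v : M, l *: v = 0 -> v = 0)
  (low : forall d (v : M), d < d0 -> gcomp d v -> v = 0)
  (high : forall (p : nat) (v : M), gcomp (d0 + q%:Z + p%:Z) v ->
     exists2 w : M, gcomp (d0 + q%:Z) w & v = l ^+ p *: w)
  (hT : frame (d0 + q%:Z) T) (hu : gcomp d0 u)
  (killed : forall r : R, restr i r = 0 -> r *: u = 0)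
  (ux0 : l ^+ q *: u = T x0) (x0j : x0 0 j != 0).

(** In degree d0 + p, the kernel of the functional that sends v to the j-th
    coordinate of l^q E_i v, after division by l^(p+n) and in the frame T of
    degree d0 + q. *)
Definition complement d (v : M) := gcomp d v /\
  forall p : nat, d = d0 + p%:Z ->
    exists2 x, l ^+ q *: (E i *: v) = l ^+ (p + n) *: T x & x 0 j = 0.

Lemma complement_homog : homog_family complement.
Proof.
have c0 d : complement d 0.
  split=> [|p _]; first exact: gcomp0.
  by exists 0; rewrite ?mxE // (frame0 hT) !scaler0.
split=> // [d v []|d v w [hv cv] [hw cw]|e d r v hr [hv cv]] //.
  split=> [|p ed]; first exact: gcompB.
  have [[x ex xj] [y ey yj]] := (cv p ed, cw p ed).
  exists (x - y); last by rewrite !mxE xj yj subr0.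
  by rewrite (frameB hT) !scalerBr ex ey.
have [ltd|led] := ltP d d0; first by rewrite (low ltd hv) scaler0.
split=> [|p ep]; first exact: gcompZ.
have [b hb] := restr_homog i hr.
have [|x ex xj] := cv (absz (d - d0)); first by lia.
exists ((b / a i ^+ e) *: x); last by rewrite mxE xj mulr0.
have -> : (p + n = e + (absz (d - d0) + n))%N by lia.
rewrite (frameZ hT); have rE : r * E i = ((b / a i ^+ e)^% * l ^+ e) * E i.
  by apply: mul_E; rewrite (restr_scaleX (restr_l i)) hb divfK // expf_neq0.
transitivity (((b / a i ^+ e)^% * l ^+ e) *: (l ^+ q *: (E i *: v))).
  rewrite !scalerA; congr (_ *: _).
  by rewrite -[LHS]mulrA [E i * r]mulrC rE [LHS]mulrA [l ^+ q * _]mulrC.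
by rewrite ex !scalerA -[in LHS]mulrA -exprD mulrC.
Qed.

Let E_u : E i *: u = l ^+ n *: u.
Proof. by apply: (scale_eq killed); rewrite restr_E eqxx. Qed.

Lemma E_line p c :
  l ^+ q *: (E i *: (c^% *: (l ^+ p *: u))) = l ^+ (p + n) *: T (c *: x0).
Proof.
have -> : E i *: (c^% *: (l ^+ p *: u)) = (c^% * l ^+ p) *: (l ^+ n *: u).
  by rewrite -E_u !scalerA -mulrA mulrC.
rewrite (frameZ hT) -ux0 !scalerA exprD; congr (_ *: _).
rewrite [l ^+ q * _]mulrC -!mulrA.
by rewrite [l ^+ n * (_ * _)]mulrCA [LHS]mulrCA [l ^+ q * _]mulrC.
Qed.

(** The functional defining [complement] takes the value x0_j <> 0 at l^p u, so
    subtracting a multiple of l^p u moves v into its kernel. *)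
Lemma line_complement_sum d v : gcomp d v -> exists v1 v2,
  [/\ line_family l d0 u d v1, complement d v2 & v = v1 + v2].
Proof.
move=> hv; have [ltd|led] := ltP d d0.
  exists 0, 0; rewrite (low ltd hv) addr0; split=> //; first by left.
  by case: complement_homog.
pose p := absz (d - d0); have ed : d = d0 + p%:Z by lia.
have : gcomp (d0 + q%:Z + (p + n)%N%:Z) (l ^+ q *: (E i *: v)).
  have := gcompZX q hl (gcompZ (hE i) hv).
  by congr gcomp; lia.
move=> /high[w hw ew]; have [_ _ /(_ w hw)[x wx] _] := hT.
pose c := x 0 j / x0 0 j.
have h1 : gcomp d (c^% *: (l ^+ p *: u)).
  by apply: gcomp_const; rewrite ed; apply: gcompZX.
exists (c^% *: (l ^+ p *: u)), (v - c^% *: (l ^+ p *: u)); split.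
- by right; exists p, c.
- split=> [|p']; first exact: gcompB.
  rewrite ed => /addrI[<-]; exists (x - c *: x0).
    by rewrite (frameB hT) !scalerBr E_line ew wx.
  by rewrite !mxE /c divfK // subrr.
- by rewrite addrC subrK.
Qed.

Lemma line_complement_cap d v : line_family l d0 u d v -> complement d v -> v = 0.
Proof.
case=> [//|[p [c [-> ->]]]] [_ /(_ p erefl)[x]].
rewrite E_line => /eqP; rewrite -subr_eq0 -scalerBr => /eqP/(regular_exp reg_l)/eqP.
rewrite subr_eq0 => /eqP; case: hT => _ _ _ /[apply] <-.
move=> /eqP; rewrite mxE mulf_eq0 (negPf x0j) orbF => /eqP->.
by rewrite cr_const0 scale0r.
Qed.

Lemma indecomposable_line : u <> 0 -> indecomposable M ->
  forall d v, gcomp d v -> line_family l d0 u d v.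
Proof.
move=> u0 indec d v hv.
have hline := line_family_homog hl (a_neq0 i) (restr_l i) hu killed.
case: (indecomposable_families indec hline complement_homog
  line_complement_sum line_complement_cap) => [line0|comp0].
  case: u0; apply: (line0 d0); right; exists 0%N, 1.
  by rewrite addr0 cr_const1 !scale1r.
have [v1 [v2 [h1 h2 ->]]] := line_complement_sum hv.
by rewrite (comp0 d v2 h2) addr0.
Qed.

End Splitting.

(** Once d - b reaches the degree of the numerator, the partial sum of its
    coefficients is the full sum, that is, the value at 1. *)
Lemma hilbert_bounds (b : int) (f : {poly int}) (h : int -> nat) (m : nat) :
    (forall d, (h d)%:Z =
       if b <= d then \sum_(i < (absz (d - b)%R).+1) f`_i else 0) ->
    m%:Z = f.[1] ->
  (forall d, d < b -> h d = 0%N) /\ (forall d, b + (size f)%:Z <= d -> h d = m).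
Proof.
move=> hh em; split=> d hd; have := hh d.
  by rewrite leNgt hd /= => -[].
have -> : b <= d by lia.
move=> e; suff : (h d)%:Z = m%:Z by case.
rewrite e em (@horner_coef_wide _ (absz (d - b)%R).+1); last by lia.
by apply: eq_bigr => p _; rewrite expr1n mulr1.
Qed.

(** In the lowest degree d0, where w <> 0 lives, the quotients of the E_i w by l^n
    lie in M_d0 and add up to w; a nonzero one is the generator. *)
Lemma Ulrich_generator (M : gmodule X) : indecomposable M -> is_Ulrich M ->
  exists i d (u : M), point_generator i d u.
Proof.
move=> indec [MCM [m [[_ min_m] [b [f [[h [dim_h hh]] em]]]]]].
have reg_l := MCM_regular MCM.
have [h_low h_high] := hilbert_bounds hh em.
have ex_p : exists p : nat, h (b + p%:Z) != 0%N.
  apply: NNPP => hno; have [[w w0] _] := indec; apply: w0.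
  elim/gmodule_ind: w => // [_ _ -> ->|d v hv]; first by rewrite addr0.
  apply: (gcomp_dim0 dim_h _ hv); have [/h_low//|led] := ltP d b.
  apply/eqP/negPn/negP => hd; apply: hno; exists (absz (d - b)).
  by rewrite (_ : b + _ = d) //; lia.
case: (ex_minnP ex_p) => {ex_p}p hp min_p; pose d0 := b + p%:Z.
have low d : d < d0 -> h d = 0%N.
  move=> ltd; have [/h_low//|led] := ltP d b.
  have [//|] := eqVneq (h d) 0%N; have -> : d = b + (absz (d - b))%:Z by lia.
  by move=> /min_p; lia.
pose q := size f; have high d : d0 + q%:Z <= d -> h d = m.
  by move=> ?; apply: h_high; lia.
have [T0 hT0] := comp_dim_frame (dim_h d0).
have [w hw w0] : exists2 w : M, gcomp d0 w & w <> 0.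
  have h0 : (0 < h d0)%N by rewrite lt0n.
  exists (T0 (delta_mx 0 (Ordinal h0))); first by case: hT0.
  rewrite -(frame0 hT0); case: hT0 => _ _ _ /[apply] /rowP/(_ (Ordinal h0)) /eqP.
  by rewrite !mxE !eqxx oner_eq0.
have [i Eiw] : exists i, E i *: w <> 0.
  apply: NNPP => hno; apply: w0; apply: (@regular_exp _ _ _ _ l n) => //.
  rewrite -sum_E scaler_suml big1 // => i _; apply: NNPP => ?.
  by apply: hno; exists i.
have [u hu eu] := Ulrich_divideX hl reg_l dim_h low high min_m (hE i) hw.
have u0 : u <> 0 by move=> u0; apply: Eiw; rewrite eu u0 scaler0.
have killed r : restr i r = 0 -> r *: u = 0.
  move=> r0; apply: (@regular_exp _ _ _ _ l n) => //.
  rewrite scalerA mulrC -scalerA -eu scalerA (@mul_E i r 0) ?raddf0 //.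
  by rewrite mul0r scale0r.
have [T hT] := comp_dim_frame (dim_h (d0 + q%:Z)).
have [x0 ux0] : exists x, l ^+ q *: u = T x.
  by have [_ _ + _] := hT; apply; apply: gcompZX.
have [j x0j] : exists j, x0 0 j != 0.
  apply: NNPP => hno; apply: u0; apply: (@regular_exp _ _ _ _ l q) => //.
  rewrite ux0 (_ : x0 = 0) ?(frame0 hT) //; apply/rowP => j; rewrite mxE.
  by apply/eqP/negPn/negP => ?; apply: hno; exists j.
have line := indecomposable_line reg_l _ _ hT hu killed ux0 x0j u0 indec.
exists i, d0, u; split=> // [v|r].
  elim/gmodule_ind: v => [|v v' [r ->] [r' ->]|d v /line].
  - by exists 0; rewrite scale0r.
  - by exists (r + r'); rewrite scalerDl.
  case=> [||->|[p' [c [_ ->]]]].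
  - by move=> d' v' ltd; apply: (gcomp_dim0 dim_h); apply: low.
  - by move=> p' v' hv'; apply: (divide_highX hl reg_l dim_h high _ hv').
  - by exists 0; rewrite scale0r.
  by exists (c^% * l ^+ p'); rewrite scalerA.
split=> [ru0|]; last exact: killed.
exact: (line_ann (a_neq0 i) (restr_l i) hu killed reg_l u0).
Qed.

End UlrichGenerator.

(** * The classification *)

Lemma Ulrich_iff_point_module (k : closedFieldType) n (X : 'I_n.+1 -> ppoint k) :
    (forall i j, i != j -> ~ same_point (X i) (X j)) ->
  forall M : gmodule X, indecomposable M /\ is_Ulrich M <->
    exists (i : 'I_n.+1) (s : int), giso M (gshift (point_module X i) s).
Proof.
move=> X_distinct M; have [l [a [hl a0 restr_l]]] := avoiding_linform X.
split=> [[indec ulrich]|[i [s /giso_generator[u gen_u]]]]; last first.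
  split; first exact: generator_indecomposable gen_u.
  exact: (generator_Ulrich hl (a0 i) (restr_l i) gen_u).
have /fin_all_exists[E hE] : forall i, exists E : coord_ring X, cr_homog n E /\
    forall j, restr j E = if j == i then restr i (l ^+ n) else 0.
  move=> i; have [E hE restr_E] := separating_form X_distinct i.
  exists (cr_const X (a i ^+ n) * E); split=> [|j]; first exact: cr_homogZ.
  rewrite rmorphM /= restr_const restr_E; case: eqP => _; last by rewrite mulr0.
  by rewrite [RHS]rmorphXn /= restr_l exprZn mul_polyC.
have [i [d [u gen_u]]] := Ulrich_generator hl a0 restr_l (fun i => (hE i).1)
  (fun i => (hE i).2) indec ulrich.
by exists i, (- d); apply: (@generator_giso _ _ _ _ _ _ u); rewrite opprK.
Qed.

Theorem corollary3p15 (k : closedFieldType)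
    (char_k : 2%N \notin [pchar k]%R)
    (X : 'I_4 -> ppoint k)
    (X_distinct : forall i j : 'I_4, i != j -> ~ same_point (X i) (X j))
    (X_general : forall i j l : 'I_4, i != j -> i != l -> j != l ->
       ~ collinear (X i) (X j) (X l)) :
  forall M : gmodule X,
    indecomposable M /\ is_Ulrich M <->
    exists (i : 'I_4) (s : int), giso M (gshift (point_module X i) s).
Proof. exact: Ulrich_iff_point_module. Qed.
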